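(* Let $h\geq 2$ be an integer and $\delta>2$ a real number. Then there exists $n_0(h,\delta)$ such that $N(h^n)\ge (\log n)^{1/\delta}$ for all $n>n_0(h,\delta)$.
   Context: A holey latin square of type $h^n$ is an $hn\times hn$ array with rows, columns and symbols indexed by $[hn]$, together with a partition of $[hn]$ into $n$ holes $H_1,\dots,H_n$ of size $h$, such that cell $(i,j)$ is empty iff $(i,j)\in\bigcup_k H_k\times H_k$ and otherwise contains one symbol, each row/column contains each symbol at most once, and symbols of $H_k$ do not appear in rows or columns indexed by $H_k$. Two such squares with the same holes are orthogonal if, superimposed, every ordered pair of symbols from different holes appears exactly once. $N(h^n)$ is the maximum number of pairwise orthogonal holey latin squares of type $h^n$ with a common hole partition. *)

(* Defs.v *)
From mathcomp Require Import all_boot all_algebra.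

Set Implicit Arguments.
Unset Strict Implicit.
Unset Printing Implicit Defensive.

(* The index set [v] is 'I_v, and [None] marks an empty cell. *)
Definition square (v : nat) := 'M[option 'I_v]_v.

Definition in_same_hole (v : nat) (P : {set {set 'I_v}}) (i j : 'I_v) : bool :=
  [exists H in P, (i \in H) && (j \in H)].

Definition is_holes (h n : nat) (P : {set {set 'I_(h * n)}}) : bool :=
  [&& partition P [set: 'I_(h * n)], #|P| == n & [forall H in P, #|H| == h]].

Arguments is_holes : clear implicits.

Definition is_hls (h n : nat) (P : {set {set 'I_(h * n)}})
    (L : square (h * n)) : bool :=
  [&& is_holes h n P,
      [forall i, forall j, (L i j == None) == in_same_hole P i j],
      [forall i, forall s, #|[set j | L i j == Some s]| <= 1],
      [forall j, forall s, #|[set i | L i j == Some s]| <= 1]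
    & [forall H in P, forall x in H, forall s in H, forall y,
         (L x y != Some s) && (L y x != Some s)]].

Arguments is_hls : clear implicits.

Definition orthogonal_hls (v : nat) (P : {set {set 'I_v}})
    (L M : square v) : bool :=
  [forall H in P, forall K in P, (H != K) ==>
    [forall a in H, forall b in K,
      #|[set c : 'I_v * 'I_v |
           (L c.1 c.2 == Some a) && (M c.1 c.2 == Some b)]| == 1]].

Definition pairwise_orthogonal_hls (h n : nat) (P : {set {set 'I_(h * n)}})
    (S : {set square (h * n)}) : bool :=
  [forall L in S, is_hls h n P L]
  && [forall L in S, forall M in S, (L != M) ==> orthogonal_hls P L M].

Arguments pairwise_orthogonal_hls : clear implicits.

(* N(h^n).  Families of squares are taken to be sets: for h >= 1 and n >= 2 no
   square is orthogonal to itself, so a pairwise orthogonal family has no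
   repetitions.  (For n = 1 indexed families would be unbounded.) *)
Definition N_hls (h n : nat) : nat :=
  \max_(S : {set square (h * n)} |
          [exists P : {set {set 'I_(h * n)}},
             pairwise_orthogonal_hls h n P S]) #|S|.

(* Main.v *)
(* Write a holey latin square family as a transversal design with holes: a list of blocks,
   one point per row, covering each pair of points of different holes exactly once.

   Over a finite field F of order q, blocks are developed by the translations of F and by a
   subgroup C of F^* of index l.  A block family then only needs, for each pair of rows and
   each pair of levels, l base blocks whose differences lie in the l distinct cosets of C.
   Differences with prescribed cosets exist when q is a large power of (2 l)^k: the second
   moment, over all cosets at once, of the number of points of a set in a random translate of
   a coset is elementary, and a greedy choice follows.  With q = Q^b and l = Q - 1 this gives
   N(h^(z^e)) >= k for every z and every e >= E, where E is k^2 up to logarithms.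

   Wilson's construction turns sizes a <= b, close to each other, into (q - j) a + j b for
   j <= q.  Starting from powers only, this produces arithmetic progressions a + U d, d < M,
   whose length M is squared at each step while U is multiplied by 2^E (or 3^E); after about
   log E steps M is much larger than U.  Two such progressions with coprime U represent all
   integers of a long interval as (q - 1) x + y, and n = 2^E a + w reaches all larger n. *)

Require Import Defs.
From mathcomp Require Import all_boot all_order all_algebra all_fingroup all_field.
From mathcomp Require Import all_classical all_reals all_analysis.
From mathcomp Require Import zify ring lra.

Set Implicit Arguments.
Unset Strict Implicit.
Unset Printing Implicit Defensive.

Import Order.TTheory GRing.Theory Num.Theory.

(** * Designs as lists of blocks *)

(** The exponent 2 is the product of two linear requirements. Transversal designs with about [k]
    rows exist from order [2 ^ (3 s ^ 2 (k + 3))] on, where [k + 3 <= 2 ^ s]; arrays with [h] levels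
    are projected from them, so the index [p ^ a - 1] must be about the fourth power of this bound
    and [a] is of order [k s ^ 2]. The greedy choice asks for a field of order [(p ^ a) ^ b] with
    [b >= 4 k + 8]. The rest loses only powers of [s], which [delta > 2] absorbs.

    The sizes then at hand are powers, which are sparse, and Wilson's step accepts [a] and [a + w]
    only when [P w <= a], and for [j > 1] only with [w = 0] or [w >= 2 ^ E]. Progressions therefore
    carry a lower bound on their step and an upper bound on their extent. Coprime steps come from
    [t = 2 ^ (2 l + 4)], which is 1 modulo 3: one step is made of 2 and [t (t + 1)], the other of 3
    and [(t + 1) ^ E - t ^ E], and [q = (t (t + 1)) ^ E] makes [q - 1] prime to the first. *)

(** Since blocks form a list, concatenation adds multiplicities: a design is assembled from partial
    ones by checking an identity between functions [m]. *)
Definition covers (k : nat) (X : finType) (m : 'I_k -> 'I_k -> X -> X -> nat) : Prop :=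
  exists B : seq {ffun 'I_k -> X}, forall i j x y, i != j ->
    count (fun b : {ffun 'I_k -> X} => (b i == x) && (b j == y)) B = m i j x y.

Lemma covers_eq k (X : finType) (m m' : 'I_k -> 'I_k -> X -> X -> nat) :
  (forall i j x y, i != j -> m i j x y = m' i j x y) -> covers m -> covers m'.
Proof. by move=> e [B H]; exists B => i j x y ij; rewrite H ?e. Qed.

Lemma covers_add k (X : finType) (m m' : 'I_k -> 'I_k -> X -> X -> nat) :
  covers m -> covers m' -> covers (fun i j x y => m i j x y + m' i j x y).
Proof.
by move=> [B H] [B' H']; exists (B ++ B') => i j x y ij; rewrite count_cat H ?H'.
Qed.

Lemma covers0 k (X : finType) : covers (fun (i j : 'I_k) (x y : X) => 0).
Proof. by exists [::]. Qed.

Lemma covers_sum (I : finType) k (X : finType) (m : I -> 'I_k -> 'I_k -> X -> X -> nat) :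
  (forall a, covers (m a)) -> covers (fun i j x y => \sum_a m a i j x y).
Proof.
move=> H.
have /(_ (index_enum I)) : forall r : seq I, covers (fun i j x y => \sum_(a <- r) m a i j x y).
  elim=> [|a r IH].
    by apply: (covers_eq _ (@covers0 k X)) => i j x y _; rewrite big_nil.
  by apply: (covers_eq _ (covers_add (H a) IH)) => i j x y _; rewrite big_cons.
by [].
Qed.

Lemma covers_sum_seq (I : Type) (r : seq I) k (X : finType)
    (m : I -> 'I_k -> 'I_k -> X -> X -> nat) :
  (forall a, covers (m a)) -> covers (fun i j x y => \sum_(a <- r) m a i j x y).
Proof.
move=> H; elim: r => [|a r IH].
  by apply: (covers_eq _ (@covers0 k X)) => i j x y _; rewrite big_nil.
by apply: (covers_eq _ (covers_add (H a) IH)) => i j x y _; rewrite big_cons.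
Qed.

Lemma covers_block k (X : finType) (f : 'I_k -> X) :
  covers (fun i j x y => (f i == x) && (f j == y) : nat).
Proof. by exists [:: [ffun i => f i]] => i j x y _ /=; rewrite !ffunE addn0. Qed.

(* A partial inverse [psi] records the image of the row-dependent embedding. *)
Lemma covers_push k (X Y : finType) (phi : 'I_k -> X -> Y) (psi : 'I_k -> Y -> option X)
    (m : 'I_k -> 'I_k -> X -> X -> nat) :
  (forall i x y, (phi i x == y) = (psi i y == Some x)) -> covers m ->
  covers (fun i j y y' =>
    if psi i y is Some x then if psi j y' is Some x' then m i j x x' else 0 else 0).
Proof.
move=> H [B HB]; exists [seq [ffun i => phi i (b i)] | b : {ffun 'I_k -> X} <- B] => i j y y' ij.
rewrite count_map.
under eq_count => b do rewrite /= !ffunE !H.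
case: (psi i y) => [x|]; last by rewrite (@eq_count _ _ pred0) ?count_pred0.
case: (psi j y') => [x'|]; last first.
  by rewrite (@eq_count _ _ pred0) ?count_pred0 // => b /=; rewrite andbF.
rewrite -HB //; apply: eq_count => b /=.
by rewrite [Some _ == _]eq_sym [Some x' == _]eq_sym.
Qed.

Lemma covers_bij k (X Y : finType) (f : X -> Y) (g : Y -> X)
    (m : 'I_k -> 'I_k -> X -> X -> nat) :
  cancel f g -> cancel g f -> covers m -> covers (fun i j y y' => m i j (g y) (g y')).
Proof.
move=> fg gf /(@covers_push k X Y (fun _ => f) (fun _ y => Some (g y))); apply=> _ x y.
by apply/eqP/eqP => [<-|[<-]]; rewrite ?fg ?gf.
Qed.

Lemma covers_rows k l (X : finType) (r : 'I_l -> 'I_k) (m : 'I_k -> 'I_k -> X -> X -> nat) :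
  injective r -> covers m -> covers (fun i j => m (r i) (r j)).
Proof.
move=> rI [B H]; exists [seq [ffun i => b (r i)] | b : {ffun 'I_k -> X} <- B] => i j x y ij.
by rewrite count_map -H ?(inj_eq rI) //; apply: eq_count => b /=; rewrite !ffunE.
Qed.

Lemma count_sum (T : Type) (P : pred T) (s : seq T) : count P s = \sum_(b <- s) P b.
Proof. by rewrite -sum1_count big_mkcond /=; apply: eq_bigr => b _; case: (P b). Qed.

(* Wilson's construction: the points of the last group of the master design carry the
   infinite points [Om] by means of [pi]. *)
Lemma covers_wilson k (X A Om : finType) (pi : Om -> X) (rho : rel X) :
  covers (fun (i j : 'I_k.+1) (x y : X) => rho x y : nat) ->
  (forall z, covers (fun (i j : 'I_k) (x y : A + Om) =>
     match x, y with
     | inl _, inl _ => 1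
     | inl _, inr o | inr o, inl _ => pi o == z : nat
     | inr _, inr _ => 0
     end)) ->
  (forall x y, rho x y = rho y x) ->
  covers (fun (i j : 'I_k) (x y : X * A + Om) =>
     match x, y with
     | inl u, inl v => rho u.1 v.1 : nat
     | inl u, inr o | inr o, inl u => rho u.1 (pi o) : nat
     | inr _, inr _ => 0
     end).
Proof.
move=> [B HB] HI rhoC.
pose up (i : 'I_k) : 'I_k.+1 := lift ord_max i.
pose phi (b : {ffun 'I_k.+1 -> X}) (i : 'I_k) (x : A + Om) : X * A + Om :=
  match x with inl a => inl (b (up i), a) | inr o => inr o end.
pose psi (b : {ffun 'I_k.+1 -> X}) (i : 'I_k) (y : X * A + Om) : option (A + Om) :=
  match y with inl u => if u.1 == b (up i) then Some (inl u.2) else None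
  | inr o => Some (inr o) end.
have Hphi b i x y : (phi b i x == y) = (psi b i y == Some x).
  case: x y => [a|o] [[x' a']|o'] //=; last by apply/eqP/eqP => [[->]|[->]].
    apply/eqP/eqP => [[<- <-]|]; first by rewrite eqxx.
    by case: eqP => // -> [->].
  by case: (x' == _).
have := covers_sum_seq B (fun b => covers_push (Hphi b) (HI (b ord_max))).
apply: covers_eq => i j x y ij.
have upn i' : up i' != ord_max by rewrite eq_sym neq_lift.
have upij : up i != up j by rewrite (inj_eq (lift_inj (h := ord_max))).
case: x y => [[x a]|o] [[y a']|o'] /=.
- rewrite -(HB (up i) (up j)) // count_sum; apply: eq_bigr => b _.
  by rewrite [x == _]eq_sym [y == _]eq_sym; case: (b _ == x) => //=; case: (b _ == y).
- rewrite -(HB (up i) ord_max) // count_sum; apply: eq_bigr => b _.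
  by rewrite [x == _]eq_sym [pi _ == _]eq_sym; case: (b _ == x).
- rewrite rhoC -(HB ord_max (up j)) ?[_ == up j]eq_sym // count_sum; apply: eq_bigr => b _.
  by rewrite [y == _]eq_sym [pi _ == _]eq_sym andbC; case: (b _ == y) => //=; rewrite ?andbF.
- by rewrite big1_eq.
Qed.

(** * Transversal designs: weighting, products, finite fields *)

Definition TD (k n : nat) : Prop := covers (fun (_ _ : 'I_k) (_ _ : 'I_n) => 1).

Lemma bij_card (X Y : finType) : #|X| = #|Y| -> exists f : X -> Y, exists2 g, cancel f g & cancel g f.
Proof.
move=> e; exists (fun x => enum_val (cast_ord e (enum_rank x))).
exists (fun y => enum_val (cast_ord (esym e) (enum_rank y))) => x.
  by rewrite enum_valK cast_ordK enum_rankK.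
by rewrite enum_valK cast_ordKV enum_rankK.
Qed.

Lemma TD_card k (X : finType) : covers (fun (_ _ : 'I_k) (_ _ : X) => 1) <-> TD k #|X|.
Proof.
have [f [g fg gf]] := bij_card (esym (card_ord #|X|)).
by split; [apply: (covers_bij fg gf)|apply: (covers_bij gf fg)].
Qed.

(** Every block of the master is blown up into a transversal design on [A]; this is Wilson's
    construction without infinite points. *)
Lemma covers_weight k (X A : finType) (rho : rel X) :
  covers (fun (i j : 'I_k) (x y : X) => rho x y : nat) -> TD k #|A| ->
  covers (fun (i j : 'I_k) (x y : X * A) => rho x.1 y.1 : nat).
Proof.
move=> [B HB] /(TD_card k A).2 HA.
pose psi (b : {ffun 'I_k -> X}) (i : 'I_k) (y : X * A) :=
  if y.1 == b i then Some y.2 else None.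
have Hphi (b : {ffun 'I_k -> X}) i (x : A) y : ((b i, x) == y) = (psi b i y == Some x).
  by case: y => y a; rewrite /psi /= xpair_eqE [y == _]eq_sym; case: (_ == y) => //=; rewrite eq_sym.
have := covers_sum_seq B (fun b => covers_push (Hphi b) HA).
apply: covers_eq => i j [x a] [y a'] ij /=.
rewrite -(HB i j) // count_sum; apply: eq_bigr => b _.
by rewrite /psi /= [x == _]eq_sym [y == _]eq_sym; case: (b _ == x) => //=; case: (b _ == y).
Qed.

Lemma TD_mul k m n : TD k m -> TD k n -> TD k (m * n).
Proof.
move=> Hm Hn; have := @covers_weight k 'I_m 'I_n (fun _ _ => true) Hm.
by rewrite card_ord => /(_ Hn) /(TD_card k ('I_m * 'I_n)%type).1; rewrite card_prod !card_ord.
Qed.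

Lemma TD1 k : TD k 1.
Proof.
apply: covers_eq (covers_block (fun _ : 'I_k => ord0 : 'I_1)) => i j x y _.
by rewrite !ord1.
Qed.

Lemma TD_le k l n : l <= k -> TD k n -> TD l n.
Proof.
move=> lk; apply: (@covers_rows _ _ _ (widen_ord lk)).
by move=> i j /(congr1 val) /= ij; apply: val_inj.
Qed.

(** The blocks are the lines [i |-> a + al i * b]: the values in two rows determine [b], then
    [a]. *)
Lemma TD_field k (F : finFieldType) : k <= #|F| -> TD k #|F|.
Proof.
move=> kF; apply/(TD_card k F).1.
pose al (i : 'I_k) : F := enum_val (widen_ord kF i).
have alI : injective al.
  by move=> i j /enum_val_inj /(congr1 val) /= ij; apply: val_inj.
have := covers_sum (fun xy : F * F => covers_block (fun i : 'I_k => (xy.1 + al i * xy.2)%R)).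
apply: covers_eq => i j x y ij.
have d0 : (al j - al i != 0)%R by rewrite subr_eq0 (inj_eq alI) eq_sym.
pose v := ((y - x) / (al j - al i))%R.
rewrite (bigD1 (x - al i * v, v)%R) //= big1 ?addn0.
  rewrite subrK eqxx /=.
  suff -> : (x - al i * v + al j * v = y)%R by rewrite eqxx.
  by rewrite -addrA [X in (x + X)%R]addrC -mulrBl /v mulrC divfK // addrC subrK.
move=> [a b] /= ne; apply/eqP; rewrite eqb0.
apply: contra ne => /andP[/eqP ex /eqP ey].
have vb : v = b.
  rewrite /v -ey -ex opprD addrACA subrr add0r -mulrBl mulrC mulrA.
  by rewrite mulVf // mul1r.
by rewrite vb -ex addrK.
Qed.

Lemma TD_primepow k p e : prime p -> 0 < e -> k <= p ^ e -> TD k (p ^ e).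
Proof.
by move=> pp e0; case: (PrimePowerField pp e0) => F _ <-; apply: TD_field.
Qed.

Lemma TD_macneish k n : 0 < n ->
  (forall p, prime p -> p %| n -> k <= p ^ logn p n) -> TD k n.
Proof.
move=> n0 H; rewrite (prod_prime_decomp n0).
rewrite prime_decompE big_map /= big_seq.
apply: big_ind; [exact: TD1|exact: TD_mul|].
move=> p; rewrite mem_primes => /and3P[pp _ pn].
by apply: TD_primepow => //; [rewrite logn_gt0 mem_primes pp n0|exact: H].
Qed.

(** * Incomplete transversal designs *)

(** The right summand is the hole, so the order is [a + w]: a transversal design lacking a subdesign
    of order [w], which need not exist itself. *)
Definition ITD (k a w : nat) : Prop :=
  covers (fun (_ _ : 'I_k) (x y : 'I_a + 'I_w) =>
    match x, y with inr _, inr _ => 0 | _, _ => 1 end).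

Lemma ITD_card k (A W : finType) :
  covers (fun (_ _ : 'I_k) (x y : A + W) =>
    match x, y with inr _, inr _ => 0 | _, _ => 1 end) <-> ITD k #|A| #|W|.
Proof.
have [f [g fg gf]] := bij_card (esym (card_ord #|A|)).
have [f' [g' fg' gf']] := bij_card (esym (card_ord #|W|)).
pose F (x : A + W) := match x with inl a => inl (f a) | inr b => inr (f' b) end.
pose G (x : 'I_#|A| + 'I_#|W|) : A + W :=
  match x with inl a => inl (g a) | inr b => inr (g' b) end.
have FG : cancel F G by case=> x /=; rewrite ?fg ?fg'.
have GF : cancel G F by case=> x /=; rewrite ?gf ?gf'.
split; [move=> /(covers_bij FG GF)|move=> /(covers_bij GF FG)];
  by apply: covers_eq => i j [x|x] [y|y] _.
Qed.

Lemma TD0 k : TD k 0.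
Proof. by exists [::] => i j []. Qed.

Lemma covers_inl k (A W : finType) (m : 'I_k -> 'I_k -> A -> A -> nat) : covers m ->
  covers (fun i j (x y : A + W) => match x, y with inl a, inl a' => m i j a a' | _, _ => 0 end).
Proof.
move=> /(@covers_push k A (A + W)%type (fun _ => inl)
  (fun _ y => match y with inl a => Some a | _ => None end)) H.
apply: covers_eq (H _); first by move=> i j [x|x] [y|y].
by move=> _ x [y|y] //=; apply/eqP/eqP => [[->]|[->]].
Qed.

Lemma covers_inr k (A W : finType) (m : 'I_k -> 'I_k -> W -> W -> nat) : covers m ->
  covers (fun i j (x y : A + W) => match x, y with inr a, inr a' => m i j a a' | _, _ => 0 end).
Proof.
move=> /(@covers_push k W (A + W)%type (fun _ => inr)
  (fun _ y => match y with inr a => Some a | _ => None end)) H.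
apply: covers_eq (H _); first by move=> i j [x|x] [y|y].
by move=> _ x [y|y] //=; apply/eqP/eqP => [[->]|[->]].
Qed.

Lemma ITD0 k a : TD k a -> ITD k a 0.
Proof.
by move=> /(@covers_inl k _ 'I_0); apply: covers_eq => i j [x|[]] // [y|[]].
Qed.

Lemma TD_fill k a w : ITD k a w -> TD k w -> TD k (a + w).
Proof.
move=> H /(@covers_inr k 'I_a) /(covers_add H) {}H.
have : covers (fun (_ _ : 'I_k) (_ _ : 'I_a + 'I_w) => 1).
  by apply: covers_eq H => i j [x|x] [y|y].
by move=> /(TD_card k ('I_a + 'I_w)%type).1; rewrite card_sum !card_ord.
Qed.

Lemma ITD_fill k a u w : ITD k a (u + w) -> ITD k u w -> ITD k (a + u) w.
Proof.
move=> H1 /(@covers_inr k 'I_a) H2.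
have {}H1 : covers (fun (_ _ : 'I_k) (x y : 'I_a + ('I_u + 'I_w)) =>
    match x, y with inr _, inr _ => 0 | _, _ => 1 end).
  by apply/ITD_card; rewrite card_sum !card_ord.
pose F (x : 'I_a + ('I_u + 'I_w)) : ('I_a + 'I_u) + 'I_w :=
  match x with inl x => inl (inl x) | inr (inl x) => inl (inr x) | inr (inr x) => inr x end.
pose G (x : ('I_a + 'I_u) + 'I_w) : 'I_a + ('I_u + 'I_w) :=
  match x with inl (inl x) => inl x | inl (inr x) => inr (inl x) | inr x => inr (inr x) end.
have FG : cancel F G by case=> [x|[x|x]].
have GF : cancel G F by case=> [[x|x]|x].
have := covers_bij FG GF (covers_add H1 H2).
move=> H; have {H} : covers (fun (_ _ : 'I_k) (x y : ('I_a + 'I_u) + 'I_w) =>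
    match x, y with inr _, inr _ => 0 | _, _ => 1 end).
  by apply: covers_eq H => i j [[x|x]|x] [[y|y]|y].
by move=> /ITD_card; rewrite card_sum !card_ord.
Qed.

Lemma covers_small k (X : finType) (m : 'I_k -> 'I_k -> X -> X -> nat) : k <= 1 -> covers m.
Proof.
by move=> k1; exists [::] => i j x y /eqP[]; apply: val_inj => /=; case: i j => i ? [j ?] /=; lia.
Qed.

(* Deleting one block, after relabelling each group so that the deleted block is constant. *)
Lemma ITD1 k a : TD k a.+1 -> ITD k a 1.
Proof.
have [k1 _|k2] := leqP k 1; first exact: covers_small.
rewrite -addn1 => H.
have {H} : covers (fun (_ _ : 'I_k) (_ _ : 'I_a + 'I_1) => 1).
  by apply/TD_card; rewrite card_sum !card_ord.
move=> [B HB]; pose pt : 'I_a + 'I_1 := inr ord0.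
have [b0 b0B] : exists b0, b0 \in B.
  have := HB (Ordinal (ltnW k2)) (Ordinal k2) pt pt isT.
  by case: (B) => [|b s] // _; exists b; rewrite mem_head.
exists [seq [ffun i => tperm (b0 i) pt (b i)] | b : {ffun 'I_k -> 'I_a + 'I_1} <- rem b0 B].
move=> i j x y ij; rewrite count_map.
under eq_count => b do rewrite /= !ffunE ![tperm _ _ _ == _](can2_eq (tpermK _ _) (tpermK _ _)).
rewrite count_rem b0B (HB _ _ _ _ ij) /=.
rewrite ![b0 _ == _]eq_sym ![tperm _ _ _ == _](can2_eq (tpermK _ _) (tpermK _ _)) !tpermL.
have ptE (z : 'I_a + 'I_1) : (z == pt) = (if z is inr _ then true else false).
  by case: z => z //; rewrite ord1 eqxx.
by rewrite !ptE; case: x => x; case: y.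
Qed.

(** Only the infinite points over [z] enter the ingredient; [insub] discards the others, which
    produces the factor [pi o == z]. *)
Lemma wilson_ingredient k (X A Om : finType) (pi : Om -> X) z :
  ITD k #|A| #|[pred o | pi o == z]| ->
  covers (fun (i j : 'I_k) (x y : A + Om) =>
     match x, y with
     | inl _, inl _ => 1
     | inl _, inr o | inr o, inl _ => pi o == z : nat
     | inr _, inr _ => 0
     end).
Proof.
rewrite -(card_sig (fun o => pi o == z)) => /(ITD_card k A {o | pi o == z}).2.
pose phi (i : 'I_k) (x : A + {o | pi o == z}) : A + Om :=
  match x with inl a => inl a | inr o => inr (val o) end.
pose psi (i : 'I_k) (y : A + Om) : option (A + {o | pi o == z}) :=
  match y with inl a => Some (inl a) | inr o => omap inr (insub o) end.
have H i x y : (phi i x == y) = (psi i y == Some x).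
  case: x y => [a|o] [a'|o'] /=.
  - by apply/eqP/eqP => [[->]|[->]].
  - by case: insubP.
  - by [].
  - case: insubP => [u pu uE|np] /=.
      apply/eqP/eqP => [[E]|[<-]]; last by rewrite uE.
      by congr (Some (inr _)); apply: val_inj; rewrite uE -E.
    by apply/eqP => -[E]; move: np; rewrite -E (valP o).
move=> /(covers_push H); apply: covers_eq => i j [x|o] [y|o'] ij //=.
- by case: insubP => [u -> _|/negbTE ->].
- by case: insubP => [u -> _|/negbTE ->].
- by case: insubP => [u _ _|_] //=; case: insubP.
Qed.

Lemma ITD_wilson k q T (om : 'I_T -> nat) :
  TD k.+1 T -> (forall z, ITD k q (om z)) -> ITD k (T * q) (\sum_z om z).
Proof.
move=> HT HI; pose Om := {z : 'I_T & 'I_(om z)}.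
have fib z : #|[pred o : Om | tag o == z]| = om z.
  rewrite -[RHS]card_ord -(card_codom (f := fun c : 'I_(om z) => Tagged (fun z => 'I_(om z)) c)).
    apply: eq_card => -[z' c]; rewrite !inE /=.
    apply/eqP/codomP => [e|[c' /(congr1 tag)] //=].
    by move: c; rewrite e => c; exists c.
  by move=> c c' /eqP; rewrite eq_Tagged /= => /eqP.
have := @covers_wilson k 'I_T 'I_q Om tag (fun _ _ => true) HT.
case=> [z|//|B HB].
  by apply: wilson_ingredient; rewrite card_ord fib.
have : covers (fun (_ _ : 'I_k) (x y : 'I_T * 'I_q + Om) =>
    match x, y with inr _, inr _ => 0 | _, _ => 1 end).
  by exists B => i j x y ij; rewrite HB //; case: x; case: y.
move=> /ITD_card; rewrite card_prod !card_ord card_tagged.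
rewrite sumnE big_map big_enum /=.
by under eq_bigr => z _ do rewrite card_ord.
Qed.

Lemma sum_ltn_ord T u : u <= T -> \sum_(z < T) (z < u : nat) = u.
Proof.
move=> uT; rewrite -(big_mkord xpredT (fun z => (z < u : nat))) (@big_cat_nat _ _ _ u 0 T) //=.
rewrite big_nat_cond (eq_bigr (fun _ => 1)); last by move=> i /andP[/andP[_ ->]].
rewrite -big_nat_cond sum_nat_const_nat subn0 muln1 big_nat_cond big1 ?addn0 //.
by move=> i /andP[/andP[]]; rewrite leqNgt => /negbTE ->.
Qed.

(** One infinite point over [u] of the [T] points of the last group calls for ingredients of orders
    [m] and [m + 1], the larger ones with a hole of size 1. *)
Lemma TD_wilson k m T u : TD k.+1 T -> TD k m -> TD k m.+1 -> u <= T -> TD k u ->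
  TD k (T * m + u).
Proof.
move=> HT Hm Hm1 uT Hu; apply: TD_fill => //; rewrite -[in X in ITD _ _ X](sum_ltn_ord uT).
by apply: ITD_wilson => // z; case: ltnP => _; [apply: ITD1|apply: ITD0].
Qed.

(** * Transversal designs of every large order *)

Lemma dvdn_modeq d m x y : d %| m -> x = y %[mod m] -> x = y %[mod d].
Proof. by move=> dm e; rewrite -(modn_dvdm x dm) e modn_dvdm. Qed.

Lemma prime_part (pi : nat_pred) p n : prime p -> 0 < n -> p \in pi -> p %| n -> p %| n`_pi.
Proof.
move=> pp n0 ppi pn; have : p \in primes n`_pi.
  by rewrite primes_part mem_filter ppi mem_primes pp n0 pn.
by rewrite mem_primes => /and3P[].
Qed.

(* Both [T] and [a + T] avoid all small primes, except that [T] is highly divisible by 2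
   when [a] is odd. *)
Lemma rough_residue k s a : 0 < s -> 1 < k -> exists c, forall T, T = c %[mod k`! ^ s] ->
  forall p, prime p -> p <= k -> ~~ (p %| a + T) /\ (p %| T -> (p == 2) && (2 ^ s %| T)).
Proof.
move=> s0 k1; set N := k`! ^ s.
have N0 : 0 < N by rewrite expn_gt0 fact_gt0.
(* The residue is 2 at odd primes dividing [a + 1] and 1 at the other odd primes, so [a + T]
   vanishes at none of them; the 2-part only fixes the parity of [a + T]. *)
pose M := N`_2^'; pose pi : nat_pred := [pred p | p %| a.+1].
pose c1 := chinese M`_pi M`_pi^' 2 1.
pose c := chinese N`_2 M (~~ odd a) c1.
have M0 : 0 < M by rewrite part_gt0.
exists c => T Tc p pp pk.
have pN : p %| N by rewrite Euclid_dvdX // s0 andbT dvdn_fact // prime_gt0.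
have T2 : T = (~~ odd a) %[mod N`_2].
  rewrite (dvdn_modeq (dvdn_part _ _) Tc) chinese_modl //; exact: coprime_partC.
have TM : T = c1 %[mod M].
  rewrite (dvdn_modeq (dvdn_part _ _) Tc) chinese_modr //; exact: coprime_partC.
have [p2|p2] := eqVneq p 2.
  have e2 : 2 %| N`_2 by apply: prime_part => //; rewrite ?inE -?p2.
  have Todd : odd T = ~~ odd a.
    have := dvdn_modeq e2 T2; rewrite !modn2 oddb; by case: (odd T); case: (odd a).
  rewrite p2 !dvdn2 oddD Todd; split; first by case: (odd a).
  rewrite negbK => oa /=; rewrite oa /= mod0n in T2.
  have /dvdn_trans : 2 ^ s %| N`_2.
    rewrite p_part pfactor_dvdn ?expn_gt0 // pfactorK // /N lognX leq_pmulr //.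
    by rewrite logn_gt0 mem_primes fact_gt0 /= dvdn_fact.
  by apply; apply/eqP.
have pM : p %| M by apply: prime_part => //; rewrite !inE.
have p3 : 2 < p by rewrite ltn_neqAle eq_sym p2 prime_gt1.
have [ppi|pnpi] := boolP (p \in pi).
  have pd : p %| M`_pi by apply: prime_part.
  have {}TM : T = 2 %[mod p].
    rewrite (dvdn_modeq pM TM) (@dvdn_modeq p M`_pi _ 2) // chinese_modl //.
    exact: coprime_partC.
  split; last by rewrite /dvdn TM modn_small.
  rewrite /dvdn -modnDmr TM modnDmr addn2 -addn1 -modnDml (eqP (ppi : p %| a.+1)) add0n.
  by rewrite modn_small // ltnW.
have pd : p %| M`_pi^' by apply: prime_part => //; rewrite !inE.
have {}TM : T = 1 %[mod p].
  rewrite (dvdn_modeq pM TM) (@dvdn_modeq p M`_pi^' _ 1) // chinese_modr //.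
  exact: coprime_partC.
split; last by rewrite /dvdn TM modn_small // ltnW.
by rewrite /dvdn -modnDmr TM modnDmr addn1; rewrite inE in pnpi.
Qed.

Lemma dvdn_predn p N : prime p -> 0 < N -> p %| N -> ~~ (p %| N.-1).
Proof.
move=> pp N0 pN; apply: contraL (prime_gt1 pp) => pN1.
by rewrite -leqNgt dvdn_leq // -(eqP (coprimenP N0)) dvdn_gcd pN.
Qed.

Lemma leq_pfactor p n : prime p -> 0 < n -> p %| n -> p <= p ^ logn p n.
Proof.
move=> pp n0 pn; rewrite -[X in X <= _]expn1 leq_exp2l ?prime_gt1 //.
by rewrite logn_gt0 mem_primes pp n0 pn.
Qed.

Lemma window_lt n b r a : n.+1 ^ 2 <= b -> n.+1 * b <= a -> r < n.+1 -> n * (b.+1 + r) < a.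
Proof.
move=> nb ba rn; have : n * (b.+1 + r) <= n * (b + n.+1) by rewrite leq_mul2l; lia.
by rewrite -mulnn in nb; lia.
Qed.

(* [a = T (N - 1) + u] with [N = k!^s]; none of [N - 1], [N], [T], [u] has a small prime-power
   factor. *)
Theorem TD_large k s a : 1 < k -> k <= 2 ^ s -> (k`! ^ s) ^ 3 <= a -> TD k.-1 a.
Proof.
move=> k1 ks; have s0 : 0 < s by case: s ks => //; rewrite expn0; case: k k1 => // [[]].
set N := k`! ^ s => aN.
have N1 : 1 < N.
  rewrite -(exp1n s) ltn_exp2r //; apply: leq_trans k1 _; exact: fact_geq.
have [c Hc] := rough_residue a s0 k1.
(* [T] is the least integer from [y] on congruent to [c] modulo [N]; being within [N] of [y], it
   leaves [0 < a - (N - 1) T <= T] because [N ^ 3 <= a]. *)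
pose y := (a %/ N).+1; pose r := (c + (N - y %% N)) %% N; pose T := y + r.
have N0 : 0 < N by apply: ltnW.
have Tc : T = c %[mod N].
  rewrite /T /r modnDmr addnCA -modnDmr -modnDml; have yN := ltn_pmod y N0.
  rewrite -[in X in c %% N + X](modn_mod y N).
  rewrite [(y + _) %% N]( _ : _ = 0) ?addn0 ?modn_mod // -modnDml subnKC ?modnn //.
  exact: ltnW.
have rN : r < N by rewrite ltn_pmod.
have ay : a < N * y by rewrite /y mulnC ltn_ceil.
have ya : N * (a %/ N) <= a by rewrite mulnC leq_trunc_div.
have aN2 : N ^ 2 <= a %/ N by rewrite leq_divRL // -expnSr.
have u0 : N.-1 * T < a.
  by apply: window_lt; rewrite (prednK N0).
pose u := a - N.-1 * T.
have uT : u <= T.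
  rewrite leq_subLR -[X in _ + X]mul1n -mulnDl addn1 (prednK N0).
  by apply: leq_trans (ltnW ay) _; rewrite leq_mul2l leq_addr orbT.
have -> : a = T * N.-1 + u by rewrite /u mulnC subnKC // ltnW.
have pk' p n : prime p -> 0 < n -> p %| n -> ~~ (p <= k) -> k <= p ^ logn p n.
  move=> pp n0 pn; rewrite -ltnNge => kp; apply: leq_trans (ltnW kp) _; exact: leq_pfactor.
have gT : TD k T.
  apply: TD_macneish; first by rewrite /T.
  move=> p pp pT; have [pk|] := boolP (p <= k); last exact: pk'.
  have [_ /(_ pT) /andP[/eqP -> H]] := Hc T Tc p pp pk.
  by apply: leq_trans ks _; rewrite leq_exp2l // -pfactor_dvdn.
have pN p : prime p -> p <= k -> p %| N.
  by move=> pp pk; rewrite Euclid_dvdX // s0 andbT dvdn_fact // prime_gt0.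
have k'k : k.-1 <= k by rewrite leq_pred.
apply: TD_wilson => //.
- by rewrite prednK // ltnW.
- apply: (TD_le k'k); apply: TD_macneish; first by rewrite -ltnS prednK.
  move=> p pp pN1; apply: pk' => //; first by rewrite -ltnS prednK.
  by apply: contraL pN1 => pk; rewrite dvdn_predn // pN.
(* A prime dividing [N] occurs in it at least [s] times, and [p ^ s >= 2 ^ s >= k]; hence the
   exponent [s] on the factorial. *)
- rewrite prednK //; apply: (TD_le k'k); apply: TD_macneish => // p pp pdN.
  apply: leq_trans ks _.
  have pf : 0 < logn p k`!.
    by rewrite logn_gt0 mem_primes pp fact_gt0 /=; rewrite Euclid_dvdX // in pdN; case/andP: pdN.
  rewrite /N lognX; apply: leq_trans (_ : p ^ s <= _).
    by rewrite leq_exp2r // prime_gt1.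
  by rewrite leq_exp2l ?prime_gt1 // leq_pmulr.
- apply: (TD_le k'k); apply: TD_macneish; first by rewrite subn_gt0.
  move=> p pp pu; apply: pk' => //; first by rewrite subn_gt0.
  (* Small primes divide [N], so modulo them [u] is [a + T], which [rough_residue] keeps nonzero. *)
  apply/negP => pk; have [/negP[]] := Hc T Tc p pp pk.
  suff -> : a + T = u + N * T by rewrite dvdn_add // dvdn_mulr // pN.
  have eN : N * T = N.-1 * T + T by rewrite -mulSnr prednK.
  by rewrite eN addnA /u subnK // ltnW.
Qed.

(** * Cosets of a multiplicative subgroup: the second moment *)

Section Cyclotomic.

Variables (F : finFieldType) (l f : nat).
Hypothesis lf : l * f = #|F|.-1.

Let q0 : 1 < #|F|. Proof. exact: card_finNzRing_gt1. Qed.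
Let l0 : 0 < l.
Proof. by rewrite lt0n; apply/eqP => e; move: lf q0; rewrite e; case: #|F| => [|[]]. Qed.
Let f0 : 0 < f.
Proof. by rewrite lt0n; apply/eqP => e; move: lf q0; rewrite e muln0; case: #|F| => [|[]]. Qed.

(** The power [x ^ f] identifies the coset of [x] modulo the [f]-th roots of unity; these [l]-th
    roots serve as names of the [l] cosets. *)
Definition unity := [set c : F | (c ^+ l == 1)%R].

Lemma card_nz : #|[set x : F | (x != 0)%R]| = l * f.
Proof.
rewrite lf -(cardsC1 (0%R : F)); apply: eq_card => x; by rewrite !inE.
Qed.

Lemma card_power_le n (c : F) : 0 < n -> #|[set x : F | (x ^+ n == c)%R]| <= n.
Proof.
move=> n0; rewrite -ltnS -(size_XnsubC c n0) cardE.
apply: max_poly_roots; first by rewrite -size_poly_gt0 size_XnsubC.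
  by apply/allP => x; rewrite mem_enum inE /root !hornerE subr_eq0.
exact: enum_uniq.
Qed.

Lemma power_unity x : (x != 0)%R -> (x ^+ f)%R \in unity.
Proof.
move=> x0; rewrite inE -exprM mulnC lf.
have := expf_card x; rewrite -[X in (_ ^+ X)%R](prednK (ltnW q0)) exprSr.
by rewrite -[X in _ = X](mul1r x) => /(mulIf x0) ->.
Qed.

Lemma unity_nz c : c \in unity -> (c != 0)%R.
Proof. by apply: contraTneq => ->; rewrite inE expr0n gtn_eqF //= eq_sym oner_eq0. Qed.

Lemma sum_fibers : \sum_(c in unity) #|[set x : F | (x ^+ f == c)%R]| = l * f.
Proof.
rewrite -card_nz -sum1_card [RHS](partition_big (fun x => (x ^+ f)%R) (mem unity)) /=; last first.
  by move=> x x0; apply: power_unity; rewrite inE in x0.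
apply: eq_bigr => c cU; rewrite -sum1_card; apply: eq_bigl => x; rewrite !inE.
case: eqP => [e|]; last by rewrite andbF.
rewrite andbT; apply/esym; apply: contraTneq cU => x0.
by apply/negP => /unity_nz; rewrite -e x0 expr0n gtn_eqF //= eqxx.
Qed.

(** The [l f] nonzero elements fall into fibres of size at most [f] over at most [l] values, so both
    bounds are attained. *)
Lemma card_unity : #|unity| = l.
Proof.
apply/eqP; rewrite eqn_leq card_power_le //= -(leq_pmul2r f0) -sum_fibers -sum_nat_const.
by apply: leq_sum => c _; apply: card_power_le.
Qed.

Lemma card_fiber c : c \in unity -> #|[set x : F | (x ^+ f == c)%R]| = f.
Proof.
move=> cU; apply/eqP; rewrite eqn_leq card_power_le //= leqNgt; apply/negP => lt.
have := sum_fibers; rewrite (bigD1 c) //= => e.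
have : \sum_(i in unity | i != c) #|[set x : F | (x ^+ f == i)%R]|
    <= \sum_(i in unity | i != c) f by apply: leq_sum => i _; apply: card_power_le.
have : \sum_(i in unity) f = l * f by rewrite sum_nat_const card_unity.
by rewrite (bigD1 c) //=; lia.
Qed.

(** The homography [v |-> (y - v) / (y' - v)] is injective and maps these [v] to [f]-th roots of
    unity other than 1. *)
Lemma card_cyclotomic (y y' : F) : y != y' ->
  #|[set v : F | ((y - v) ^+ f == (y' - v) ^+ f)%R && ((y - v) != 0)%R]| <= f.-1.
Proof.
move=> yy'; have U1 : 1%R \in unity by rewrite inE expr1n.
have -> : f.-1 = #|[set x : F | (x ^+ f == 1)%R] :\ 1%R|.
  have := card_fiber U1; rewrite (cardsD1 1%R) inE expr1n eqxx => e.
  by rewrite -[X in X.-1 = _]e.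
set V := [set v | _].
have VP v : v \in V -> [/\ (y - v != 0)%R, (y' - v != 0)%R & ((y - v) ^+ f = (y' - v) ^+ f)%R].
  rewrite inE => /andP[/eqP e n]; split=> //.
  by apply: contraNneq n => n; move/eqP: e; rewrite n expr0n gtn_eqF // expf_eq0 f0.
pose u v := ((y - v) / (y' - v))%R.
have uI : {in V &, injective u}.
  move=> v w /VP[_ nv _] /VP[_ nw _] /eqP; rewrite eqr_div // => /eqP e.
  have : ((y - y') * (v - w) = 0)%R.
    transitivity ((y - v) * (y' - w) - (y - w) * (y' - v))%R; first by ring.
    by rewrite e subrr.
  by move/eqP; rewrite mulf_eq0 !subr_eq0 (negbTE yy') => /eqP.
rewrite -(card_in_imset uI); apply: subset_leq_card; apply/fintype.subsetP => _ /imsetP[v vV ->].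
have [nv nw e] := VP v vV; rewrite !inE expr_div_n e divff ?expf_neq0 // eqxx andbT.
apply: contra yy' => /eqP e1.
have : (y - v = y' - v)%R by rewrite -[LHS](divfK nw) -/(u v) e1 mul1r.
by move=> /addIr ->.
Qed.

Variable Y : {set F}.

Definition coset_count c v := #|[set y in Y | ((y - v) ^+ f == c)%R]|.

Lemma sum_cnt : \sum_(c in unity) \sum_v coset_count c v = #|Y| * (l * f).
Proof.
under eq_bigr => c cU.
  under eq_bigr => v _ do rewrite /coset_count -sum1dep_card big_mkcondr /=.
  rewrite exchange_big /=.
  under eq_bigr => y _.
    rewrite -big_mkcond /= sum1dep_card.
    have -> : #|[set v | ((y - v) ^+ f == c)%R]| = f.
      rewrite -[RHS](card_fiber cU) -[RHS](card_imset _ (inv_inj (subKr y))).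
      apply: eq_card => x; rewrite inE; apply/idP/imsetP => [xf|[v]].
        by exists (y - x)%R; rewrite ?inE // subKr.
      by rewrite inE => /eqP e ->; rewrite subKr e.
    over.
  rewrite sum_nat_const; over.
by rewrite sum_nat_const card_unity; lia.
Qed.

(* Summed over all cosets [c], the number of [v] with [y - v] and [y' - v] both in [c] does not
   depend on the class of [y - y']; this replaces Weil's bound. *)
Lemma sum_cnt2 : \sum_(c in unity) \sum_v coset_count c v ^ 2 <= #|Y| * (l * f) + #|Y| ^ 2 * f.-1.
Proof.
have -> : \sum_(c in unity) \sum_v coset_count c v ^ 2 =
   \sum_(y in Y) \sum_(y' in Y) #|[set v : F | ((y - v) ^+ f == (y' - v) ^+ f)%R && ((y - v) != 0)%R]|.
  transitivity (\sum_(c in unity) \sum_v \sum_(y in Y) \sum_(y' in Y)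
      (((y - v) ^+ f == c)%R && ((y' - v) ^+ f == c)%R : nat)).
    apply: eq_bigr => c _; apply: eq_bigr => v _.
    have cE : coset_count c v = \sum_(y in Y) (((y - v) ^+ f == c)%R : nat).
      by rewrite /coset_count -sum1dep_card big_mkcondr; apply: eq_bigr => y _; case: (_ == _).
    rewrite -mulnn cE big_distrl /=; apply: eq_bigr => y _.
    by rewrite big_distrr /=; apply: eq_bigr => y' _; rewrite mulnb.
  under eq_bigr => c _ do rewrite exchange_big /=.
  rewrite exchange_big /=; apply: eq_bigr => y _.
  under eq_bigr => c _ do rewrite exchange_big /=.
  rewrite exchange_big /=; apply: eq_bigr => y' _.
  rewrite exchange_big /= -sum1dep_card [RHS]big_mkcond /=; apply: eq_bigr => v _.
  have [e|ne] := eqVneq (y - v)%R 0%R.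
    rewrite andbF big1 // => c /unity_nz c0; rewrite e expr0n gtn_eqF //=.
    by rewrite eq_sym (negbTE c0).
  rewrite andbT (bigD1 ((y - v) ^+ f)%R) /=; last exact: power_unity.
  rewrite eqxx /= big1 ?addn0; first by rewrite eq_sym; case: (_ == _).
  by move=> c /andP[_ /negbTE]; rewrite eq_sym => ->.
have yle y : y \in Y -> \sum_(y' in Y)
    #|[set v : F | ((y - v) ^+ f == (y' - v) ^+ f)%R && ((y - v) != 0)%R]| <= l * f + #|Y| * f.-1.
  move=> yY; rewrite (bigD1 y) //=; apply: leq_add.
    rewrite -card_nz -[X in X <= _](card_imset _ (inv_inj (subKr y))).
    apply: subset_leq_card; apply/fintype.subsetP => _ /imsetP[v vV ->].
    by move: vV; rewrite !inE => /andP[].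
  rewrite mulnC [X in _ <= X](_ : _ = \sum_(i in Y) f.-1); last by rewrite sum_nat_const mulnC.
  rewrite [X in _ <= X](bigD1 y) //=; apply: leq_trans (leq_addl _ _).
  by apply: leq_sum => y' /andP[_]; rewrite eq_sym; apply: card_cyclotomic.
apply: (@leq_trans (\sum_(y in Y) (l * f + #|Y| * f.-1))); first exact: leq_sum.
by rewrite sum_nat_const mulnDr [X in _ + X <= _]mulnA mulnn.
Qed.

(** Chebyshev's inequality: the mean count [n f / q] is at least [3 n / (4 l)] once [q >= 4], so a
    bad [v] deviates by at least [n / (4 l)]. *)
Lemma card_bad c : c \in unity -> 3 < #|F| ->
  #|[set v | 2 * l * coset_count c v < #|Y|]| * #|Y| <= 16 * l ^ 2 * #|F|.
Proof.
move=> cU q4; set q := #|F|; set n := #|Y|; set bad := [set v | _].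
(* [q] times the deviation of the count from its mean. *)
pose D c v : rat := (q%:R * (coset_count c v)%:R - n%:R * f%:R)%R.
have qE : (l%:R * f%:R = q%:R - 1 :> rat)%R.
  by rewrite -natrM lf -(natrB _ (ltnW q0)) subn1.
have sD : (\sum_(c in unity) \sum_v D c v ^+ 2 <= q%:R ^+ 3 * n%:R)%R.
  have -> : (\sum_(c in unity) \sum_v D c v ^+ 2 =
     q%:R ^+ 2 * (\sum_(c in unity) \sum_v coset_count c v ^ 2)%:R
     - 2 * q%:R * n%:R * f%:R * (\sum_(c in unity) \sum_v coset_count c v)%:R
     + l%:R * q%:R * (n%:R * f%:R) ^+ 2)%R.
    rewrite !natr_sum !mulr_sumr -sumrB.
    have -> : (l%:R * q%:R * (n%:R * f%:R) ^+ 2 = \sum_(c in unity) q%:R * (n%:R * f%:R) ^+ 2 :> rat)%R.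
      by rewrite sumr_const card_unity -[RHS]mulr_natl mulrA.
    rewrite -big_split /=; apply: eq_bigr => c' _.
    rewrite !natr_sum !mulr_sumr -sumrB.
    have -> : (q%:R * (n%:R * f%:R) ^+ 2 = \sum_(v : F) (n%:R * f%:R) ^+ 2 :> rat)%R.
      by rewrite sumr_const -[RHS]mulr_natl.
    rewrite -big_split /=; apply: eq_bigr => v _.
    by rewrite /D natrX; ring.
  have h1 := sum_cnt; have h2 := sum_cnt2.
  rewrite h1; rewrite -(ler_nat rat) in h2.
  have {}h2 := ler_wpM2l (exprn_ge0 2 (ler0n rat q)) h2; apply: le_trans (lerD (lerB h2 (lexx _)) (lexx _)) _.
  have f1 : (f.-1%:R = f%:R - 1 :> rat)%R by rewrite -subn1 natrB.
  rewrite natrD (natrM _ (n ^ 2)) natrX !natrM f1 -/n.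
  set Q := (q%:R)%R in qE *; set m := (n%:R)%R; set g := (f%:R)%R in qE *; set L := (l%:R)%R in qE *.
  have -> : (Q ^+ 2 * (m * (L * g) + m ^+ 2 * (g - 1)) - 2 * Q * m * g * (m * (L * g)) + L * Q * (m * g) ^+ 2
    = Q ^+ 2 * m * (L * g) + Q ^+ 2 * m ^+ 2 * (g - 1) - (L * g) * (Q * m ^+ 2 * g))%R by ring.
  rewrite qE -subr_ge0.
  have -> : (Q ^+ 3 * m - (Q ^+ 2 * m * (Q - 1) + Q ^+ 2 * m ^+ 2 * (g - 1) - (Q - 1) * (Q * m ^+ 2 * g))
     = Q * m * (Q * (1 + m) - m * g))%R by ring.
  have gQ : (g <= Q)%R by rewrite ler_nat; move: lf q0 l0; rewrite /q; nia.
  have m0 : (0 <= m)%R by rewrite ler0n.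
  have Q0 : (0 <= Q)%R by rewrite ler0n.
  by apply: mulr_ge0; [exact: mulr_ge0|nra].
have {}sD : (\sum_(v in bad) D c v ^+ 2 <= q%:R ^+ 3 * n%:R)%R.
  apply: le_trans sD; rewrite [X in (_ <= X)%R](bigD1 c) //=.
  apply: ler_wpDr; first by apply: sumr_ge0 => c' _; apply: sumr_ge0 => v _; apply: sqr_ge0.
  rewrite big_mkcond /=; apply: ler_sum => v _; case: ifP => // _; exact: sqr_ge0.
have bD v : v \in bad -> (q%:R ^+ 2 * n%:R ^+ 2 <= 16 * l%:R ^+ 2 * D c v ^+ 2)%R.
  rewrite inE -/n => vb.
  have : (q%:R * n%:R <= - (4 * l%:R * D c v))%R.
    have {}vb : ((2 * l * coset_count c v)%:R <= n%:R :> rat)%R by rewrite ler_nat ltnW.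
    rewrite !natrM in vb; have {}vb := ler_wpM2l (ler0n rat q) vb.
    have -> : (4 * l%:R * D c v = 2 * (q%:R * (2 * l%:R * (coset_count c v)%:R)) - 4 * n%:R * (l%:R * f%:R))%R.
      by rewrite /D; ring.
    rewrite qE.
    have q4' : (4 <= q%:R :> rat)%R by rewrite (ler_nat _ 4).
    have n0 := ler0n rat n; nra.
  move=> h; have h0 : (0 <= q%:R * n%:R :> rat)%R by rewrite mulr_ge0.
  have : ((q%:R * n%:R) ^+ 2 <= (4 * l%:R * D c v) ^+ 2)%R.
    by rewrite -[X in (_ <= X)%R]sqrrN lerXn2r // nnegrE // (le_trans h0 h).
  rewrite !exprMn; have -> : (4 ^+ 2 = 16 :> rat)%R by ring.
  by [].
have : (#|bad|%:R * (q%:R ^+ 2 * n%:R ^+ 2) <= 16 * l%:R ^+ 2 * (q%:R ^+ 3 * n%:R) :> rat)%R.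
  apply: le_trans (ler_wpM2l _ sD); last by rewrite mulr_ge0 // ?exprn_ge0.
  by rewrite mulr_natl -sumr_const mulr_sumr; apply: ler_sum.
rewrite -!natrX -!natrM ler_nat => h.
have [n00|n0] := posnP n; first by rewrite n00 muln0.
have q00 : 0 < q ^ 2 * n by rewrite muln_gt0 expn_gt0 n0 andbT (ltnW q0).
rewrite -(leq_pmul2r q00); apply: leq_trans (_ : #|bad| * (q ^ 2 * n ^ 2) <= _).
  by rewrite -mulnn; lia.
by apply: leq_trans h _; rewrite !expnS expn0; lia.
Qed.

End Cyclotomic.

(** * Cyclotomic development *)

(* Greedy choice: [v] is taken in the first set so that it has many neighbours of the prescribed
   colour in every other set. *)
Lemma clique (F : finFieldType) l f n s (lf : l * f = #|F|.-1) (F4 : 3 < #|F|) :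
  16 * n * l ^ 2 * #|F| < s ^ 2 ->
  forall m (Y : 'I_m -> {set F}) (c : 'I_m -> 'I_m -> F), m <= n ->
  (forall i j, c i j \in unity F l) -> (forall i, (2 * l) ^ m * s <= #|Y i|) ->
  exists e : 'I_m -> F, (forall i, e i \in Y i) /\
    (forall i j : 'I_m, i < j -> ((e j - e i) ^+ f = c i j)%R).
Proof.
move=> sb; have s0 : 0 < s by case: s sb.
have l0 : 0 < l by rewrite lt0n; apply/eqP => e; move: lf F4; rewrite e; case: #|F| => [|[]].
elim=> [|m IH] Y c mn cU Ys; first by exists (fun _ => 0%R); split; case.
have big i : s <= #|Y i| by apply: leq_trans (Ys i); rewrite leq_pmull // expn_gt0 muln_gt0 l0.
pose bad j := [set v | 2 * l * coset_count f (Y j) (c ord0 j) v < #|Y j|].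
have badle j : #|bad j| * s <= 16 * l ^ 2 * #|F|.
  by apply: leq_trans (card_bad lf (Y j) (cU ord0 j) F4); rewrite leq_mul2l big orbT.
(* The bad sets together have fewer elements than [Y ord0]: otherwise
   [s ^ 2 <= |Y ord0| s <= 16 n l ^ 2 q], against the choice of [s]. *)
have [v vY vbad] : exists2 v, v \in Y ord0 & v \notin \bigcup_(j : 'I_m) bad (lift ord0 j).
  apply/exists_inP; apply: contraLR sb; rewrite negb_exists_in => /forall_inP sub.
  have {}sub : Y ord0 \subset \bigcup_(j : 'I_m) bad (lift ord0 j).
    by apply/fintype.subsetP => v /sub; rewrite negbK.
  rewrite -leqNgt -mulnn; apply: leq_trans (_ : #|Y ord0| * s <= _); first by rewrite leq_mul2r big orbT.
  apply: leq_trans (_ : (\sum_(j : 'I_m) #|bad (lift ord0 j)|) * s <= _).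
    rewrite leq_mul2r; apply/orP; right; apply: leq_trans (subset_leq_card sub) _.
    elim/big_rec2: _ => [|j a b _ h]; first by rewrite cards0.
    by apply: leq_trans (leq_add (leqnn _) h); rewrite cardsU leq_subr.
  rewrite big_distrl /=; apply: leq_trans (_ : \sum_(j < m) 16 * l ^ 2 * #|F| <= _).
    by apply: leq_sum => j _; apply: badle.
  rewrite sum_nat_const card_ord; apply: leq_trans (leq_mul (ltnW mn) (leqnn _)) _.
  by rewrite [16 * n]mulnC !mulnA.
pose Y' (j : 'I_m) := [set y in Y (lift ord0 j) | ((y - v) ^+ f == c ord0 (lift ord0 j))%R].
have [|i j|i|e' [e'Y e'c]] := IH Y' (fun i j => c (lift ord0 i) (lift ord0 j)).
- exact: ltnW.
- exact: cU.
- have : v \notin bad (lift ord0 i) by apply: contra vbad => vb; apply/bigcupP; exists i.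
  rewrite inE -leqNgt -/(coset_count _ _ _ _) => h; rewrite -(@leq_pmul2l (2 * l)) ?muln_gt0 ?l0 //.
  by rewrite mulnA -expnS; apply: leq_trans (Ys _) h.
exists (fun i => if unlift ord0 i is Some j then e' j else v); split=> [i|i j].
  by case: unliftP => [j|] -> //; have := e'Y j; rewrite inE => /andP[].
case: unliftP => [j'|] ->; case: unliftP => [i'|] -> h.
- by apply: e'c; rewrite /= /bump /= in h; lia.
- by have := e'Y j'; rewrite inE => /andP[_ /eqP].
- by rewrite /= ltn0 in h.
- by rewrite ltnn in h.
Qed.

Lemma count_positions (T : Type) (s : seq T) (P : pred T) :
  #|[set p : 'I_(size s) | P (tnth (in_tuple s) p)]| = count P s.
Proof. by rewrite -sum1_count big_tnth -sum1dep_card. Qed.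

(* [S] indexes levels, which are translated by [F]; [T] indexes orbits of infinite points, which
   the subgroup of [f]-th roots of unity permutes regularly. *)
Lemma covers_cyclotomic (F : finFieldType) l f k s (S T : finType) :
  l * f = #|F|.-1 -> 3 < #|F| ->
  16 * k * l ^ 2 * #|F| < s ^ 2 -> (2 * l) ^ k * s <= #|F| ->
  covers (fun (i j : 'I_k) (x y : S + T) =>
    match x, y with
    | inl _, inl _ => l
    | inr _, inr _ => 0
    | _, _ => 1
    end) ->
  covers (fun (i j : 'I_k) (x y : S * F + T * {x : F | (x ^+ f == 1)%R}) =>
    match x, y with
    | inl u, inl v => u.2 != v.2 : nat
    | inr _, inr _ => 0
    | _, _ => 1
    end).
Proof.
move=> lf F4 sb sF [B HB].
pose X p := tnth (in_tuple B) p.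
pose cls i j a b := [set p : 'I_(size B) | (X p i == a) && (X p j == b)].
have clsE i j a b : i != j -> #|cls i j a b| = match a, b with
    | inl _, inl _ => l | inr _, inr _ => 0 | _, _ => 1 end.
  by move=> ij; rewrite /cls (count_positions _ (fun b0 : {ffun _} => (b0 i == a) && (b0 j == b))) HB.
have U1 : 1%R \in unity F l by rewrite inE expr1n.
(* The blocks covering one pair of levels are numbered and matched with the cosets. The default 1
   can occur only for [i = j], where the colour is irrelevant. *)
pose col (p : 'I_(size B)) i j : F :=
  nth 1%R (enum (unity F l)) (index p (enum (cls i j (X p i) (X p j)))).
have colU p i j : col p i j \in unity F l.
  rewrite /col; have [h|h] := ltnP (index p (enum (cls i j (X p i) (X p j)))) (size (enum (unity F l))).
    by rewrite -mem_enum mem_nth.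
  by rewrite nth_default.
have l0 : 0 < l by rewrite lt0n; apply/eqP => e; move: lf F4; rewrite e; case: #|F| => [|[]].
have f0 : 0 < f by rewrite lt0n; apply/eqP => e; move: lf F4; rewrite e muln0; case: #|F| => [|[]].
have E p : exists e : 'I_k -> F, forall i j : 'I_k, i < j -> ((e j - e i) ^+ f = col p i j)%R.
  have [|e [_ He]] := clique lf F4 sb (Y := fun _ => [set: F]) (leqnn k) (colU p).
    by move=> i; rewrite cardsT.
  by exists e.
have {E} [e He] : exists e : 'I_(size B) -> 'I_k -> F,
    forall p (i j : 'I_k), i < j -> ((e p j - e p i) ^+ f = col p i j)%R.
  exact: (fin_all_exists E).
pose C : finType := {x : F | (x ^+ f == 1)%R}.
(* Finite entries are multiplied and translated; an infinite entry records the multiplier, so that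
   it and a finite entry determine the translation. *)
pose blk (pvm : 'I_(size B) * F * C) (i : 'I_k) : S * F + T * C :=
  match X pvm.1.1 i with
  | inl a => inl (a, val pvm.2 * e pvm.1.1 i + pvm.1.2)%R
  | inr t => inr (t, pvm.2)
  end.
have Cnz (m : C) : (val m != 0)%R.
  apply: contraTneq (valP m) => ->; by rewrite expr0n gtn_eqF //= eq_sym oner_eq0.
have enz p (i j : 'I_k) : i < j -> (e p j - e p i != 0)%R.
  move=> ij; have := unity_nz lf (colU p i j); rewrite -(He p i j ij).
  by rewrite expf_eq0 f0.
have := covers_sum (fun pvm => covers_block (blk pvm)).
apply: covers_eq => i j x y ij.
wlog {ij} ij : i j x y / i < j.
  move=> H; have [lt|lt|/val_inj eq] := ltngtP i j; [exact: H| |by rewrite eq eqxx in ij].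
  under eq_bigr => a _ do rewrite andbC.
  rewrite H //; case: x => [u|u]; case: y => [v|v] //; by rewrite eq_sym.
have ijn : i != j by rewrite -val_eqE /= ltn_eqF.
case: x y => [[a x]|[t m]] [[b y]|[t' m']] /=.
- have [xy|xy] := eqVneq x y.
    apply: big1 => -[[p v] m] _; apply/eqP; rewrite eqb0 /blk /=.
    case: (X p i) => [a'|t0]; last by [].
    case: (X p j) => [b'|t0]; last by rewrite andbF.
    apply/negP => /andP[/eqP[_ ex] /eqP[_ ey]].
    move: (enz p i j ij); rewrite -(mulrI_eq0 _ (mulfI (Cnz m))) mulrBr.
    move: xy; rewrite -ex -ey => /addIr ->; by rewrite subrr eqxx.
  (* The coset of [d] selects the base block, the quotient of [d] by its difference is the
     multiplier, and the translation is then forced. *)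
  pose d := (y - x)%R; have d0 : (d != 0)%R by rewrite subr_eq0 eq_sym.
  have dU := power_unity lf d0.
  have szU : size (enum (unity F l)) = l by rewrite -cardE (card_unity lf).
  have szc : size (enum (cls i j (inl a) (inl b))) = l by rewrite -cardE clsE.
  pose idx := index (d ^+ f)%R (enum (unity F l)).
  have idxl : idx < l by rewrite -szU index_mem mem_enum.
  have p0 : 'I_(size B).
    by case: (enum (cls i j (inl a) (inl b))) szc l0 => [<-|p _ _].
  pose p := nth p0 (enum (cls i j (inl a) (inl b))) idx.
  have pc : p \in cls i j (inl a) (inl b) by rewrite -mem_enum mem_nth ?szc.
  have [Xi Xj] : X p i = inl a /\ X p j = inl b by move: pc; rewrite inE => /andP[/eqP -> /eqP ->].
  have colE : col p i j = (d ^+ f)%R.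
    by rewrite /col Xi Xj index_uniq ?szc ?enum_uniq // nth_index ?mem_enum.
  pose m := (d / (e p j - e p i))%R.
  have mC : (m ^+ f == 1)%R.
    by rewrite expr_div_n He // colE divff // expf_neq0.
  pose pvm0 : 'I_(size B) * F * C := (p, x - m * e p i, Sub m mC)%R.
  rewrite (bigD1 pvm0) //= big1 ?addn0.
    rewrite /blk /= Xi Xj addrCA subrr addr0 eqxx /=.
    have -> : (m * e p j + (x - m * e p i) = y)%R.
      rewrite addrCA -mulrBr /m divfK ?enz // /d addrC subrK //.
    by rewrite eqxx.
  move=> [[p' v'] m'] /= ne; apply/eqP; rewrite eqb0; apply: contra ne.
  rewrite /blk /=; case Xi' : (X p' i) => [a'|t0]; last by [].
  case Xj' : (X p' j) => [b'|t0]; last by rewrite andbF.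
  move=> /andP[/eqP[ea ex] /eqP[eb ey]].
  have dE : (d = val m' * (e p' j - e p' i))%R by rewrite /d -ex -ey mulrBr opprD addrACA subrr addr0.
  have p'c : p' \in enum (cls i j (inl a) (inl b)) by rewrite mem_enum inE Xi' Xj' ea eb !eqxx.
  have col' : col p' i j = (d ^+ f)%R.
    by rewrite -(He p' i j ij) dE exprMn (eqP (valP m')) mul1r.
  have pp : p' = p.
    rewrite /p /idx -col' /col Xi' Xj' ea eb index_uniq ?enum_uniq ?nth_index //.
    by rewrite szU -szc index_mem.
  have mm : val m' = m by rewrite /m -pp dE mulfK // enz.
  have vE : v' = (x - m * e p i)%R by rewrite -ex pp mm addrAC subrr add0r.
  by apply/eqP; rewrite /pvm0 -vE pp; congr (_, _); apply: val_inj.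
- have /cards1P[p pE] : #|cls i j (inl a) (inr t')| == 1 by rewrite clsE.
  have pP p' : (X p' i == inl a) && (X p' j == inr t') = (p' == p).
    by have /setP/(_ p') := pE; rewrite !inE.
  have [/eqP Xi /eqP Xj] : X p i == inl a /\ X p j == inr t' by apply/andP; rewrite pP.
  pose pvm0 : 'I_(size B) * F * C := (p, x - val m' * e p i, m')%R.
  rewrite (bigD1 pvm0) //= big1 ?addn0.
    by rewrite /blk /= Xi Xj addrCA subrr addr0 !eqxx.
  move=> [[p' v'] mu] /= ne; apply/eqP; rewrite eqb0; apply: contra ne.
  rewrite /blk /=; case Xi' : (X p' i) => [a'|t0]; last by [].
  case Xj' : (X p' j) => [b'|t'']; first by rewrite andbF.
  move=> /andP[/eqP[ea ex] /eqP[et em]].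
  have /eqP pp : p' == p by rewrite -pP Xi' Xj' ea et !eqxx.
  by apply/eqP; rewrite /pvm0 -ex -em pp addrAC subrr add0r.
- have /cards1P[p pE] : #|cls i j (inr t) (inl b)| == 1 by rewrite clsE.
  have pP p' : (X p' i == inr t) && (X p' j == inl b) = (p' == p).
    by have /setP/(_ p') := pE; rewrite !inE.
  have [/eqP Xi /eqP Xj] : X p i == inr t /\ X p j == inl b by apply/andP; rewrite pP.
  pose pvm0 : 'I_(size B) * F * C := (p, y - val m * e p j, m)%R.
  rewrite (bigD1 pvm0) //= big1 ?addn0.
    by rewrite /blk /= Xi Xj addrCA subrr addr0 !eqxx.
  move=> [[p' v'] mu] /= ne; apply/eqP; rewrite eqb0; apply: contra ne.
  rewrite /blk /=; case Xi' : (X p' i) => [a'|t'']; first by [].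
  case Xj' : (X p' j) => [b'|t0]; last by rewrite andbF.
  move=> /andP[/eqP[et em] /eqP[eb ey]].
  have /eqP pp : p' == p by rewrite -pP Xi' Xj' eb et !eqxx.
  by apply/eqP; rewrite /pvm0 -ey -em pp addrAC subrr add0r.
- apply: big1 => -[[p v] mu] _; apply/eqP; rewrite eqb0 /blk /=.
  case Xi : (X p i) => [a'|t1]; first by [].
  case Xj : (X p j) => [b'|t2]; first by rewrite andbF.
  apply/negP => /andP[/eqP[e1 _] /eqP[e2 _]].
  have := clsE i j (inr t) (inr t') ijn; move/eqP; rewrite cards_eq0 => /eqP/setP/(_ p).
  by rewrite !inE Xi Xj e1 e2 !eqxx.
Qed.

(** * Holey transversal designs *)

Definition HTD (k h n : nat) : Prop :=
  covers (fun (_ _ : 'I_k) (x y : 'I_n * 'I_h) => x.1 != y.1 : nat).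

Lemma HTD_card k (J H : finType) :
  covers (fun (_ _ : 'I_k) (x y : J * H) => x.1 != y.1 : nat) <-> HTD k #|H| #|J|.
Proof.
have [f [g fg gf]] := bij_card (esym (card_ord #|J|)).
have [f' [g' fg' gf']] := bij_card (esym (card_ord #|H|)).
pose P (x : J * H) := (f x.1, f' x.2).
pose G (x : 'I_#|J| * 'I_#|H|) := (g x.1, g' x.2).
have PG : cancel P G by case=> x y; rewrite /G /= fg fg'.
have GP : cancel G P by case=> x y; rewrite /P /= gf gf'.
split; [move=> /(covers_bij PG GP)|move=> /(covers_bij GP PG)];
  apply: covers_eq => i j [x1 x2] [y1 y2] _ /=.
  by rewrite (can_eq gf).
by rewrite (can_eq fg).
Qed.

Lemma HTD_le k l h n : l <= k -> HTD k h n -> HTD l h n.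
Proof.
move=> lk; apply: (@covers_rows _ _ _ (widen_ord lk)).
by move=> i j /(congr1 val) /= ij; apply: val_inj.
Qed.

Lemma HTD1 k h : HTD k h 1.
Proof. by apply: covers_eq (covers0 _ _) => i j x y _; rewrite !ord1 eqxx. Qed.

(* The infinite points of the [j] enlarged holes form a design of type [(h w)^j]. *)
Lemma HTD_op k h q j a w : HTD k.+1 h q -> j <= q -> TD k a -> ITD k a w ->
  j <= 1 \/ HTD k h j /\ TD k w -> HTD k h a -> HTD k h (a + w) ->
  HTD k h (q * a + j * w).
Proof.
move=> Hq jq Ta Iaw Hj Ha Haw.
pose Om := ('I_j * 'I_h * 'I_w)%type.
pose pi (o : Om) : 'I_q * 'I_h := (widen_ord jq o.1.1, o.1.2).
pose Y := ('I_q * 'I_h * 'I_a + Om)%type.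
(* [tau] is the hole of the master over which a point lies, [sig] the hole of the design being
   built. *)
pose tau (y : Y) : 'I_q := match y with inl u => u.1.1 | inr o => (pi o).1 end.
pose sig (y : Y) : 'I_q * 'I_a + 'I_j * 'I_w :=
  match y with inl u => inl (u.1.1, u.2) | inr o => inr (o.1.1, o.2) end.
have wI : injective (widen_ord jq) by move=> x y /(congr1 val) /= e; apply: val_inj.
(* Different master holes, not both points infinite: this is Wilson's construction. *)
have H1 : covers (fun (_ _ : 'I_k) (x y : Y) => (tau x != tau y) &&
    ~~ (match x, y with inr _, inr _ => true | _, _ => false end) : nat).
  have := @covers_wilson k ('I_q * 'I_h)%type 'I_a Om pi (fun x y => x.1 != y.1) Hq.
  case=> [z|x y|B HB].
  - apply: wilson_ingredient; rewrite card_ord.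
    have [zj|zj] := ltnP z.1 j.
      rewrite (_ : #|_| = w) // -[RHS]card_ord.
      pose g (c : 'I_w) : Om := (Ordinal zj, z.2, c).
      have gI : injective g by move=> c c' /(congr1 snd).
      rewrite -(card_codom gI); apply: eq_card => -[[x1 x2] x3]; rewrite !inE.
      apply/eqP/codomP => [e|[c [-> -> ->]]]; last by rewrite [RHS]surjective_pairing; congr (_, _); apply: val_inj.
      by exists x3; rewrite /g; congr (_, _, _); [apply: val_inj|]; rewrite /= -e.
    rewrite (_ : #|_| = 0); first exact: ITD0.
    apply: eq_card0 => o; rewrite !inE; apply/eqP => e; move: zj; rewrite -e /=.
    by rewrite leqNgt (ltn_ord o.1.1).
  - by rewrite eq_sym.
  - exists B => x y u v xy; rewrite HB //; case: u => u; case: v => v //=; rewrite ?andbT ?andbF //.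
    by rewrite eq_sym.
(* Two infinite points over different master holes: the design of type [h ^ j] weighted by [w]. For
   [j <= 1] there is no such pair. *)
have H2 : covers (fun (_ _ : 'I_k) (x y : Y) => (tau x != tau y) &&
    (match x, y with inr _, inr _ => true | _, _ => false end) : nat).
  have : covers (fun (_ _ : 'I_k) (x y : Om) => x.1.1 != y.1.1 : nat).
    case: Hj => [j1|[Hj Tw]].
      apply: covers_eq (covers0 _ _) => x y [[u1 ?] ?] [[v1 ?] ?] _ /=.
      suff -> : u1 = v1 by rewrite eqxx.
      by apply: val_inj; move: (ltn_ord u1) (ltn_ord v1) => /=; lia.
    have := @covers_weight k _ 'I_w (fun x y => x.1 != y.1) Hj.
    by rewrite card_ord; apply.
  move=> /(@covers_inr k ('I_q * 'I_h * 'I_a)%type); apply: covers_eq => x y [u|u] [v|v] _ //=;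
    by rewrite ?andbF // andbT (inj_eq wI).
(* Within one master hole: it is split into [a + w] or [a] holes of size [h], according to whether
   it carries infinite points. *)
have H3 i : covers (fun (_ _ : 'I_k) (x y : Y) => [&& tau x == i, tau y == i & sig x != sig y] : nat).
  have [ij|ij] := ltnP i j.
    pose i0 := Ordinal ij; have i0E : i = widen_ord jq i0 by apply: val_inj.
    pose phi (_ : 'I_k) (x : ('I_a + 'I_w) * 'I_h) : Y :=
      match x.1 with inl c => inl (i, x.2, c) | inr c => inr (i0, x.2, c) end.
    pose psi (_ : 'I_k) (y : Y) : option (('I_a + 'I_w) * 'I_h) :=
      match y with
      | inl u => if u.1.1 == i then Some (inl u.2, u.1.2) else None
      | inr o => if o.1.1 == i0 then Some (inr o.2, o.1.2) else None
      end.
    have E r x y : (phi r x == y) = (psi r y == Some x).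
      case: x y => [[c|c] s] [[[u1 u2] u3]|[[u1 u2] u3]]; rewrite /phi /psi /=.
      - apply/eqP/idP => [[<- <- <-]|]; first by rewrite !eqxx.
        by case: (u1 =P i) => // -> /eqP[-> ->].
      - by case: (u1 == i0).
      - by case: (u1 == i).
      - apply/eqP/idP => [[<- <- <-]|]; first by rewrite !eqxx.
        by case: (u1 =P i0) => // -> /eqP[-> ->].
    have : covers (fun (_ _ : 'I_k) (x y : ('I_a + 'I_w) * 'I_h) => x.1 != y.1 : nat).
      by apply/HTD_card; rewrite card_sum !card_ord.
    move=> /(covers_push E); apply: covers_eq => r r' x y _.
    case: x => [[[u1 u2] u3]|[[u1 u2] u3]]; case: y => [[[v1 v2] v3]|[[v1 v2] v3]];
      rewrite /psi /= /pi /= ?[in X in _ = X]i0E ?(inj_eq wI) -?i0E.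
    + by have [->|] := eqVneq u1 i => //=; have [->|] := eqVneq v1 i => //=; congr (nat_of_bool (~~ _)); apply/eqP/eqP => [[->]|[->]].
    + by case: (u1 == i); case: (v1 == i0).
    + by case: (u1 == i0); case: (v1 == i).
    + by have [->|] := eqVneq u1 i0 => //=; have [->|] := eqVneq v1 i0 => //=; congr (nat_of_bool (~~ _)); apply/eqP/eqP => [[->]|[->]].
  pose phi (_ : 'I_k) (x : 'I_a * 'I_h) : Y := inl (i, x.2, x.1).
  pose psi (_ : 'I_k) (y : Y) : option ('I_a * 'I_h) :=
      match y with
      | inl u => if u.1.1 == i then Some (u.2, u.1.2) else None
      | inr o => None
      end.
  have E r x y : (phi r x == y) = (psi r y == Some x).
    case: x y => [c s] [[[u1 u2] u3]|[[u1 u2] u3]] //; rewrite /phi /psi /=.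
    apply/eqP/idP => [[<- <- <-]|]; first by rewrite !eqxx.
    by case: (u1 =P i) => // -> /eqP[-> ->].
  have ni (u : 'I_j) : (widen_ord jq u == i) = false.
    by apply/eqP => e; move: ij; rewrite -e leqNgt (ltn_ord u).
  have /(covers_push E) := Ha; apply: covers_eq => r r' x y _.
  case: x => [[[u1 u2] u3]|[[u1 u2] u3]]; case: y => [[[v1 v2] v3]|[[v1 v2] v3]];
      rewrite /psi /= /pi /= ?ni ?andbF ?if_same //; last by case: (u1 == i).
  by have [->|] := eqVneq u1 i => //=; have [->|] := eqVneq v1 i => //=; congr (nat_of_bool (~~ _)); apply/eqP/eqP => [->|[->]].
have := covers_add (covers_add H1 H2) (covers_sum H3) => H4.
have {H4} H4 : covers (fun (_ _ : 'I_k) (x y : Y) => sig x != sig y : nat).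
  apply: covers_eq H4 => r r' x y _.
  rewrite (bigD1 (tau x)) //= eqxx big1 ?addn0 /=; last first.
    by move=> i /negbTE ni; rewrite eq_sym ni.
  have tsig : sig x = sig y -> tau x = tau y.
    by case: x y => [u|[[u1 u2] u3]] [v|[[v1 v2] v3]] //=; [case|case=> ->].
  have [e|ne] := eqVneq (tau x) (tau y); first by rewrite !andTb !andFb.
  have -> : sig x != sig y by apply: contra ne => /eqP /tsig ->.
  by rewrite !andTb andFb addn0; case: (match x with inl _ => _ | inr _ => _ end).
pose P (y : Y) : ('I_q * 'I_a + 'I_j * 'I_w) * 'I_h :=
  match y with inl u => (inl (u.1.1, u.2), u.1.2) | inr u => (inr (u.1.1, u.2), u.1.2) end.
pose G (x : ('I_q * 'I_a + 'I_j * 'I_w) * 'I_h) : Y :=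
  match x.1 with inl u => inl (u.1, x.2, u.2) | inr u => inr (u.1, x.2, u.2) end.
have PG : cancel P G by case=> [[[? ?] ?]|[[? ?] ?]].
have GP : cancel G P by case=> [[[? ?]|[? ?]] ?].
have := covers_bij PG GP H4.
have : forall x, sig (G x) = x.1 by case=> [[[? ?]|[? ?]] ?].
move=> sG {}H4; have {H4} : covers (fun (_ _ : 'I_k) (x y : ('I_q * 'I_a + 'I_j * 'I_w) * 'I_h) => x.1 != y.1 : nat).
  by apply: covers_eq H4 => r r' x y _; rewrite !sG.
by move=> /HTD_card; rewrite card_sum !card_prod !card_ord.
Qed.

(** * Orthogonal arrays of every large index *)

Lemma covers_proj k (X Z : finType) :
  covers (fun (_ _ : 'I_k) (_ _ : X * Z) => 1) ->
  covers (fun (_ _ : 'I_k) (_ _ : X) => #|Z| ^ 2).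
Proof.
move=> [B HB]; exists [seq [ffun i => (b i).1] | b : {ffun 'I_k -> X * Z} <- B] => i j x y ij.
rewrite count_map count_sum.
transitivity (\sum_(uv : Z * Z) count (fun b : {ffun 'I_k -> X * Z} => (b i == (x, uv.1)) && (b j == (y, uv.2))) B).
  under [RHS]eq_bigr => uv _ do rewrite count_sum.
  rewrite exchange_big /=; apply: eq_bigr => b _; rewrite !ffunE.
  rewrite (bigD1 ((b i).2, (b j).2)) //= big1 ?addn0.
    by case: (b i) (b j) => [b1 b2] [c1 c2] /=; rewrite !xpair_eqE !eqxx !andbT.
  move=> [u v] /= ne; apply/eqP; rewrite eqb0; apply: contra ne => /andP[/eqP -> /eqP ->].
  by rewrite /= eqxx.
under eq_bigr => uv _ do rewrite HB //.
by rewrite sum1_card card_prod mulnn.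
Qed.

Lemma coprime_solve a b n c : 0 < a -> coprime a b ->
  exists y, [/\ c <= y, y < c + a & b * y = n %[mod a]].
Proof.
move=> a0 ab.
have [u Hu] : exists u, b * u = 1 %[mod a].
  have [b0|b0] := posnP b.
    by exists 0; move: ab; rewrite b0 /coprime gcdn0 => /eqP ->; rewrite !modn1.
  have [u v e _] := egcdnP a b0; exists u; rewrite mulnC e.
  by rewrite gcdnC (eqP ab) modnMDl.
pose r := (u * n + (a - c %% a)) %% a.
exists (c + r); split; [exact: leq_addr|by rewrite ltn_add2l ltn_pmod|].
have -> : b * (c + r) = b * (u * n) %[mod a].
  rewrite -modnMmr /r modnDmr addnCA -[(_ + (c + _)) %% a]modnDmr.
  have -> : (c + (a - c %% a)) %% a = 0.
    by rewrite -modnDml subnKC ?modnn // ltnW // ltn_pmod.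
  by rewrite addn0 modnMmr.
by rewrite mulnA -modnMml Hu modnMml mul1n.
Qed.

Lemma frobenius a b n : 0 < a -> coprime a b -> a * b <= n ->
  exists x y, n = a * x + b * y.
Proof.
move=> a0 ab abn; have [y [_ ya e]] := coprime_solve n 0 a0 ab; rewrite add0n in ya.
have byn : b * y <= n by apply: leq_trans abn; rewrite mulnC leq_mul2r ltnW ?orbT.
have /dvdnP[x E] : a %| n - b * y by rewrite -eqn_mod_dvd // e.
by exists x, y; rewrite mulnC -E subnK.
Qed.

(** Orthogonal array of strength two with [h] levels and index [l]. *)
Definition OA k h l : Prop := covers (fun (_ _ : 'I_k) (_ _ : 'I_h) => l).

Lemma OA_mul k h l c : OA k h l -> OA k h (l * c).
Proof.
move=> H; elim: c => [|c IH]; first by apply: covers_eq (covers0 _ _) => *; rewrite muln0.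
by apply: covers_eq (covers_add H IH) => *; rewrite mulnS.
Qed.

Lemma OA_TD k h v : TD k (h * v) -> OA k h (v ^ 2).
Proof.
move=> H; have : covers (fun (_ _ : 'I_k) (_ _ : 'I_h * 'I_v) => 1).
  by apply/TD_card; rewrite card_prod !card_ord.
by move=> /covers_proj; rewrite card_ord.
Qed.

(** Projection gives the indices [T0 ^ 2] and [(T0 + 1) ^ 2], which are coprime; repeated copies
    reach every index beyond their product. *)
Lemma OA_large k h T0 l : 0 < h -> 0 < T0 -> (forall a, T0 <= a -> TD k a) ->
  T0 ^ 2 * T0.+1 ^ 2 <= l -> OA k h l.
Proof.
move=> h0 T00 HT ll.
have le v : T0 <= v -> T0 <= h * v by move=> /leq_trans; apply; rewrite leq_pmull.
have [|//|x [y ->]] := frobenius _ _ ll; first by rewrite expn_gt0 T00.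
  by rewrite coprimeXl // coprimeXr // coprimenS.
by apply: covers_add; apply: OA_mul; apply: OA_TD; apply: HT; apply: le.
Qed.

(** * Ingredients from prime powers *)

Lemma card_lt3_power Q b k : 1 < Q -> 4 * k + 8 <= b -> 3 < Q ^ b.
Proof.
move=> Q1 kb; apply: leq_trans (_ : 2 ^ 2 <= _) => //; apply: leq_trans (_ : Q ^ 2 <= _).
  by rewrite leq_exp2r.
by rewrite leq_exp2l //; lia.
Qed.

(** The greedy threshold is [Q ^ (b - 2 k)]: the [k] choices lose [(2 l) ^ k <= Q ^ (2 k)] for
    [l = Q - 1], and [16 k l ^ 2 < Q ^ 7] makes [4 k + 7 <= b] enough for the second moment. *)
Lemma cyclotomic_params Q b k : 1 < Q -> k <= Q -> 4 * k + 8 <= b ->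
  16 * k * Q.-1 ^ 2 * Q ^ b < (Q ^ (b - 2 * k)) ^ 2 /\
  (2 * Q.-1) ^ k * Q ^ (b - 2 * k) <= Q ^ b.
Proof.
move=> Q1 kQ kb; have Q0 : 0 < Q by apply: ltnW.
split.
  apply: leq_trans (_ : Q ^ (4 + 1 + 2 + b) <= _).
    rewrite [in X in _ <= X]expnD ltn_pmul2r ?expn_gt0 ?Q0 // [in X in _ <= X]expnD.
    apply: leq_ltn_trans (_ : Q ^ (4 + 1) * Q.-1 ^ 2 < _).
      rewrite leq_mul2r expnD expn1; apply/orP; right; apply: leq_mul => //.
      by rewrite -[16]/(2 ^ 4) leq_exp2r.
    by rewrite ltn_pmul2l ?expn_gt0 ?Q0 // ltn_exp2r // prednK.
  by rewrite -expnM leq_exp2l //; lia.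
apply: leq_trans (_ : Q ^ (2 * k) * Q ^ (b - 2 * k) <= _).
  rewrite leq_mul2r; apply/orP; right; rewrite expnM.
  case: k {kQ kb} => [|k]; first by rewrite !expn0.
  by rewrite leq_exp2r // -mulnn leq_mul // leq_pred.
by rewrite -expnD subnKC //; lia.
Qed.

(** Elements of the field name the holes and the [h] points of a hole are the levels; the array of
    index [p ^ a - 1] supplies the base blocks for each pair of levels. *)
Lemma HTD_primepow k h p a b : prime p -> 0 < a -> k <= p ^ a -> 4 * k + 8 <= b ->
  OA k h (p ^ a).-1 -> HTD k h (p ^ (a * b)).
Proof.
move=> pp a0 ka kb Hoa.
have Q1 : 1 < p ^ a by apply: leq_trans (prime_gt1 pp) _; rewrite -{1}[p]expn1 leq_exp2l ?prime_gt1.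
have ab : 0 < a * b by rewrite muln_gt0 a0; lia.
have [F _ cF] := PrimePowerField pp ab.
have [h1 h2] := cyclotomic_params Q1 ka kb.
have /dvdnP[f Ef] := dvdn_pred_predX (p ^ a) b.
have lf : (p ^ a).-1 * f = #|F|.-1 by rewrite cF expnM Ef mulnC.
have := @covers_cyclotomic F _ f k _ 'I_h void lf; rewrite cF expnM.
case/(_ _ (card_lt3_power Q1 kb) h1 h2) => [|B HB].
  have : covers (fun (_ _ : 'I_k) (x y : 'I_h + void) =>
     match x, y with inl _, inl _ => (p ^ a).-1 | _, _ => 0 end) by apply: covers_inl.
  by apply: covers_eq => i j [x|[]] [y|[]].
pose Y := ('I_h * F + void * {x : F | (x ^+ f == 1)%R})%type.
pose P (y : Y) : F * 'I_h := match y with inl u => (u.2, u.1) | inr u => match u.1 with end end.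
pose G (y : F * 'I_h) : Y := inl (y.2, y.1).
have PG : cancel P G by case=> [[]|[[]]].
have GP : cancel G P by case.
have : covers (fun (i j : 'I_k) (x y : Y) =>
    match x, y with inl u, inl v => u.2 != v.2 : nat | inr _, inr _ => 0 | _, _ => 1 end).
  by exists B.
by move=> /(covers_bij PG GP) /HTD_card; rewrite cF card_ord expnM.
Qed.

Lemma ord_neq_gt1 k (i j : 'I_k) : i != j -> 1 < k.
Proof. by move: (ltn_ord i) (ltn_ord j); rewrite -val_eqE /=; lia. Qed.

(** With one level and one orbit of infinite points, that orbit is the hole: its pairs are never
    covered by the development. *)
Lemma ITD_primepow k p a b : prime p -> 0 < a -> k <= p ^ a -> 4 * k + 8 <= b ->
  ITD k (p ^ (a * b)) ((p ^ (a * b)).-1 %/ (p ^ a).-1).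
Proof.
move=> pp a0 ka kb.
have Q1 : 1 < p ^ a by apply: leq_trans (prime_gt1 pp) _; rewrite -{1}[p]expn1 leq_exp2l ?prime_gt1.
have ab : 0 < a * b by rewrite muln_gt0 a0; lia.
have [F _ cF] := PrimePowerField pp ab.
have [h1 h2] := cyclotomic_params Q1 ka kb.
have /dvdnP[f Ef] := dvdn_pred_predX (p ^ a) b.
have lf : (p ^ a).-1 * f = #|F|.-1 by rewrite cF expnM Ef mulnC.
have Q10 : 0 < (p ^ a).-1 by rewrite -ltnS prednK // ltnW.
rewrite expnM Ef mulnK //.
set l := (p ^ a).-1 in lf *.
(* Two given rows are both finite in [k - 2] of the [k] blocks having one infinite entry; [g]
   constant blocks raise this number to [l], and [k <= p ^ a] ensures [k - 2 <= l]. *)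
pose g := l - (k - 2).
have Hcol : covers (fun (i j : 'I_k) (x y : unit + unit) =>
    match x, y with inl _, inl _ => l | inr _, inr _ => 0 | _, _ => 1 end).
  pose B1 (r i : 'I_k) : unit + unit := if i == r then inr tt else inl tt.
  have := covers_add (covers_sum (fun r => covers_block (B1 r)))
    (covers_sum (fun _ : 'I_g => covers_block (fun _ : 'I_k => inl tt : unit + unit))).
  apply: covers_eq => i j x y ij.
  have k2 := ord_neq_gt1 ij.
  have r0 (r : 'I_k) : (i == r) && (j == r) = false.
    by apply/negbTE; apply: contra ij => /andP[/eqP -> /eqP ->].
  rewrite sum_nat_const card_ord /B1.
  case: x y => [[]|[]] [[]|[]] /=.
  - rewrite muln1 (bigD1 i) //= eqxx /= (bigD1 j) 1?eq_sym //= eqxx !add0n andbF add0n.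
    rewrite (eq_bigr (fun _ => 1)).
      rewrite sum1_card (_ : #|_| = k - 2); first by rewrite subnKC // leq_subLR addnC (leq_trans ka) // /l; case: (p ^ a) => // n; rewrite addn2 ltnW.
      rewrite (eq_card (B := ~: [set i; j])); last by move=> r; rewrite !inE negb_or.
      by rewrite cardsCs finset.setCK cards2 ij card_ord.
    by move=> r /andP[/negbTE ri /negbTE rj]; rewrite ![_ == r]eq_sym ri rj.
  - rewrite muln0 addn0 (bigD1 j) //= eqxx (negbTE ij) /= big1 // => r /negbTE rj.
    by rewrite [j == r]eq_sym rj andbF.
  - rewrite muln0 addn0 (bigD1 i) //= eqxx [j == i]eq_sym (negbTE ij) /= big1 // => r /negbTE ri.
    by rewrite [i == r]eq_sym ri.
  - rewrite muln0 addn0 big1 // => r _; have := r0 r.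
    by case: (i == r); case: (j == r).
have H0 := @covers_cyclotomic F _ f k _ unit unit lf; rewrite cF expnM in H0.
have H := H0 _ (card_lt3_power Q1 kb) h1 h2 Hcol.
(* Constant blocks cover the pairs of equal field elements, which the development misses. *)
have := covers_add H (covers_sum (fun v : F => covers_block (fun _ : 'I_k => inl (tt, v) : unit * F + unit * {x : F | (x ^+ f == 1)%R}))).
move=> {}H; have {}H : covers (fun (_ _ : 'I_k) (x y : unit * F + unit * {x : F | (x ^+ f == 1)%R}) =>
    match x, y with inr _, inr _ => 0 | _, _ => 1 end).
  apply: covers_eq H => i j [[[] x]|x] [[[] y]|y] _ /=.
  - rewrite (bigD1 x) //= eqxx /= big1 ?addn0.
      have -> : (inl (tt, x) == inl (tt, y) :> unit * F + unit * {x : F | (x ^+ f == 1)%R}) = (x == y).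
        by apply/eqP/eqP => [[]|->].
      by case: (x == y).
    by move=> v vx; case: eqP => [[e]|//]; rewrite e eqxx in vx.
  - by rewrite big1 // => v _; rewrite andbF.
  - by rewrite big1 // => v _.
  - by rewrite big1 // => v _.
move/ITD_card: H; rewrite !card_prod card_unit !mul1n cF expnM card_sig.
suff -> : #|[pred x : F | (x ^+ f == 1)%R]| = f by [].
have U1 : 1%R \in unity F l by rewrite inE expr1n.
by rewrite -[RHS](card_fiber lf U1); apply: eq_card => x; rewrite !inE.
Qed.

(** With [y = y1 f + y0], points of the last group carry [f] infinite points, then one, then none;
    the slack [f * f] ensures [y1 + y0 <= T]. *)
Lemma ITD_mult k T0 q f T y : (forall a, T0 <= a -> TD k.+1 a) -> T0 <= q -> ITD k q f ->
  0 < f -> T0 <= T -> y + f * f <= f * T -> ITD k (T * q) y.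
Proof.
move=> HT Tq Hf f0 TT yT.
have HTk a : T0 <= a -> TD k a by move=> /HT; apply: TD_le.
pose y1 := y %/ f; pose y0 := y %% f; have yE : y = y1 * f + y0 := divn_eq y f.
have y0f : y0 < f by rewrite ltn_mod.
have yy : y1 + y0 <= T by rewrite -(leq_pmul2l f0); nia.
pose om (z : 'I_T) := if z < y1 then f else (z < y1 + y0 : nat).
have omS : \sum_z om z = y.
  apply/eqP; rewrite -(eqn_add2r y1); apply/eqP.
  have e1 := sum_ltn_ord (leq_trans (leq_addr y0 y1) yy).
  rewrite -{1}e1 -big_split /=.
  transitivity (\sum_(z < T) (f * (z < y1) + (z < y1 + y0))).
    apply: eq_bigr => z _; rewrite /om; case: ltnP => zy /=; last by rewrite muln0 addn0.
    by rewrite muln1 (leq_trans zy) ?leq_addr.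
  by rewrite big_split -big_distrr /= e1 sum_ltn_ord // yE; lia.
rewrite -omS; apply: ITD_wilson; first exact: HT.
move=> z; rewrite /om; case: ifP => // _; case: ltnP => _.
  by apply: ITD1; apply: HTk; apply: leq_trans Tq _.
by apply: ITD0; apply: HTk.
Qed.

Lemma cyclotomic_quotient X q f : 1 < X -> 1 < q -> f * X.-1 = q.-1 ->
  [/\ 0 < f, q <= f * X & f <= q].
Proof.
case: X => // X X1 q1; rewrite /= mulnS => e.
have f0 : 0 < f by rewrite lt0n; apply/eqP => f0; move: e; rewrite f0; lia.
have X0 : 0 < X by lia.
by have := leq_pmulr f X0; split=> //; lia.
Qed.

(** [T'] is taken near [a / (4 X q')]. Then [T' q'] is about [a / (4 X)], small enough for a hole of
    size up to about [T q / X], while [f' T'] is at least about [a / (4 X X')], which still exceeds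
    [w]. *)
Lemma two_term_split X X' q q' f f' a w : 1 < X -> 2 < X' -> 0 < q -> 0 < q' -> coprime q q' ->
  q <= f * X -> q' <= f' * X' -> f <= q -> f' <= q' -> 0 < f -> 0 < f' ->
  64 * X * X' * (q + q') ^ 2 <= a -> 8 * X * X' * w <= a ->
  exists T T', [/\ a = T * q + T' * q', q <= T, q <= T',
    w + f' * f' <= f' * T' & T' * q' + w + f * f <= f * T].
Proof.
move=> X2 X3 q0 q'0 cop fq fq' fle fle' f0 f'0 Ta wa.
pose c := a %/ (4 * X * q'); have D0 : 0 < 4 * X * q' by rewrite !muln_gt0 q'0; lia.
have c1 : c * (4 * X * q') <= a by apply: leq_trunc_div.
have c2 : a < c.+1 * (4 * X * q') by apply: ltn_ceil.
clearbody c.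
have [T' [cT T'c e]] := coprime_solve a c q0 cop.
pose u := T' * q'.
have sq : q * q + q' * q' + 2 * (q * q') = (q + q') ^ 2 by rewrite sqrnD !mulnn.
pose D := X * X'; have XD : 3 * X <= D by rewrite /D mulnC leq_mul2l X3 orbT.
have XqD z : 3 * (X * z) <= D * z by rewrite mulnA leq_mul2r XD orbT.
have q1D z : 6 * z <= D * z by rewrite leq_mul2r; lia.
have {sq}Ta : 64 * (D * (q * q)) + 64 * (D * (q' * q')) + 128 * (D * (q * q')) <= a.
  by apply: leq_trans Ta; rewrite -sq /D; lia.
have {}wa : 8 * (D * w) <= a by apply: leq_trans wa; rewrite /D; lia.
have cq : q <= c.
  rewrite leqNgt; apply/negP => cq; have : c.+1 * (4 * X * q') <= q * (4 * X * q') by rewrite leq_mul2r cq orbT.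
  by have := XqD (q * q'); lia.
have qT' : q <= T' := leq_trans cq cT.
have uT : u <= q' * c + q * q' by rewrite /u mulnC [q * q']mulnC -mulnDr leq_mul2l ltnW ?orbT.
have Xu : 4 * (X * u) <= a + 4 * (X * (q * q')).
  have : X * u <= X * (q' * c) + X * (q * q') by rewrite -mulnDr leq_mul2l uT orbT.
  by lia.
have uX : 2 * u <= X * u by rewrite leq_mul2r X2 orbT.
have h1 := XqD (q * q'); have h2 := XqD (q * q); have h3 := XqD (q' * q'); have h4 := q1D (q * q').
have h5 := q1D (q * q).
have ua : u <= a by lia.
have /dvdnP[T ET] : q %| a - u by rewrite -eqn_mod_dvd // /u mulnC e.
have aE : a = T * q + u by rewrite -ET subnK.
have qT : q <= T by rewrite -(leq_pmul2r q0) -ET; lia.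
exists T, T'; split=> //.
  have : 8 * D * (w + f' * f') <= 8 * D * (f' * T').
    have g1 : D * (f' * f') <= D * (q' * q') by rewrite leq_mul2l leq_mul ?orbT.
    have g2 : X * q' * c <= D * (f' * T').
      rewrite (_ : D * _ = X * (f' * X') * T'); last by rewrite /D; lia.
      by apply: leq_mul => //; rewrite leq_mul2l fq' orbT.
    have g3 : X * q' <= X * (q' * q') by rewrite leq_mul2l leq_pmulr ?orbT.
    by rewrite mulnDr -!mulnA; lia.
  by rewrite leq_pmul2l // muln_gt0 /D muln_gt0 (ltnW X2) (ltnW (ltnW X3)).
rewrite -/u.
have : X * (u + w + f * f) <= X * (f * T).
  have g1 : X * (f * f) <= X * (q * q) by rewrite leq_mul2l leq_mul ?orbT.
  have g2 : T * q <= X * (f * T) by rewrite mulnC mulnA [X * f]mulnC leq_mul2r fq orbT.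
  have g4 := XqD w.
  by rewrite !mulnDr; lia.
by rewrite leq_pmul2l // ltnW.
Qed.

(* [a = T q + T' q'] with [q], [q'] powers of 2 and 3; the hole of size [T' q' + w] left by the
   first term is filled by the second one. *)
Lemma ITD_all k T0 x b a w : (forall a, T0 <= a -> TD k.+1 a) -> 0 < x -> k <= 2 ^ x ->
  4 * k + 8 <= b ->
  let q := 2 ^ (x * b) in let q' := 3 ^ (x * b) in T0 <= q ->
  64 * 2 ^ x * 3 ^ x * (q + q') ^ 2 <= a -> 8 * 2 ^ x * 3 ^ x * w <= a -> ITD k a w.
Proof.
move=> HT x0 kx kb q q' Tq Ta wa; have b0 : 0 < b by apply: leq_trans kb; rewrite addnS.
have kx3 : k <= 3 ^ x by apply: leq_trans kx _; rewrite leq_exp2r.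
have H2 := @ITD_primepow k 2 x b isT x0 kx kb.
have H3 := @ITD_primepow k 3 x b isT x0 kx3 kb.
rewrite -/q -/q' in H2 H3.
set f := _ %/ _ in H2; set f' := _ %/ _ in H3.
have e2 : f * (2 ^ x).-1 = q.-1.
  by rewrite /f divnK // /q expnM dvdn_pred_predX.
have e3 : f' * (3 ^ x).-1 = q'.-1.
  by rewrite /f' divnK // /q' expnM dvdn_pred_predX.
have X2 : 1 < 2 ^ x by rewrite -{1}[2]expn1 leq_exp2l.
have X3 : 2 < 3 ^ x by rewrite -{1}[3]expn1 leq_exp2l.
have qq' : q <= q' by rewrite leq_exp2r // muln_gt0 x0.
have cop : coprime q q' by rewrite coprimeXl // coprimeXr.
have xb0 : 0 < x * b by rewrite muln_gt0 x0.
have q1 : 1 < q by rewrite -(expn0 2) ltn_exp2l.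
have q'1 : 1 < q' by rewrite -(expn0 3) ltn_exp2l.
have [f0 fq fle] := cyclotomic_quotient X2 q1 e2.
have [f'0 fq' fle'] := cyclotomic_quotient (ltnW X3) q'1 e3.
have [T [T' [-> qT qT' h1 h2]]] :=
  two_term_split X2 X3 (ltnW q1) (ltnW q'1) cop fq fq' fle fle' f0 f'0 Ta wa.
apply: ITD_fill.
  by apply: (ITD_mult HT Tq H2) => //; apply: leq_trans Tq qT.
by apply: (ITD_mult HT _ H3) => //; [apply: leq_trans Tq qq'|apply: leq_trans Tq qT'].
Qed.

(** * All high powers as numbers of holes *)

Section Powers.

Variables (k h T0 u : nat).
Hypotheses (h0 : 0 < h) (T00 : 0 < T0) (HT : forall a, T0 <= a -> TD k.+1 a).
Hypotheses (uT : T0 ^ 2 * T0.+1 ^ 2 < 2 ^ u) (uk : 4 * k.+1 + 8 <= u).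

Let u0 : 0 < u. Proof. by apply: leq_trans uk; rewrite addnS. Qed.

Let reachable n := HTD k h n /\ TD k n.

Lemma reachable_mul p a b n : prime p -> u <= a -> u <= b -> reachable n ->
  reachable (p ^ (a * b) * n).
Proof.
move=> pp ua ub [Hn Tn].
have ku2 : k.+1 <= 2 ^ u by apply: leq_trans (ltnW (ltn_expl u (isT : 1 < 2))); lia.
have up : 2 ^ u <= p ^ a.
  by apply: leq_trans (leq_pexp2l _ ua); rewrite ?leq_exp2r // ?prime_gt1 ?prime_gt0.
have ka : k.+1 <= p ^ a := leq_trans ku2 up.
have a0 : 0 < a := leq_trans u0 ua.
have Hq : HTD k.+1 h (p ^ (a * b)).
  apply: HTD_primepow => //; first exact: leq_trans uk ub.
  apply: (@OA_large k.+1 h T0) => //.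
  by rewrite -ltnS prednK ?expn_gt0 ?prime_gt0 //; apply: leq_trans uT up.
have ab : 0 < a * b by rewrite muln_gt0 a0 (leq_trans u0 ub).
split.
  have := @HTD_op k h (p ^ (a * b)) 0 n 0 Hq (leq0n _) Tn (ITD0 Tn) (or_introl isT) Hn.
  by rewrite !addn0; apply.
apply: TD_mul Tn; apply: TD_primepow => //; apply: leq_trans (ltnW ka) _.
by rewrite leq_pexp2l ?prime_gt0 // leq_pmulr // (leq_trans u0 ub).
Qed.

(** An exponent from [3 u ^ 2 + 2 u = (u + 1) 2 u + u ^ 2] on is [u x + (u + 1) y] with [u <= x] and
    [u <= y < 2 u], so a prime to this exponent is a product of two prime powers of the required
    shape; [z ^ e] is built prime by prime. *)
Lemma reachable_power z e : 0 < z -> 3 * u ^ 2 + 2 * u <= e -> reachable (z ^ e).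
Proof.
move=> z0 ue.
have step p v n : prime p -> 0 < v -> reachable n -> reachable (p ^ (v * e) * n).
  move=> pp v0 Hn; have {}ue : 3 * u ^ 2 + 2 * u <= v * e.
    by apply: leq_trans ue _; rewrite leq_pmull.
  move: (v * e) ue => e' ue.
  have [y [uy yu ye]] := coprime_solve e' u u0 (coprimenS u).
  have ub : u.+1 * y + u * u <= e'.
    apply: leq_trans ue; have : u.+1 * y <= u.+1 * (u + u) by rewrite leq_mul2l ltnW.
    by rewrite -mulnn; lia.
  have ye' : u.+1 * y <= e' by apply: leq_trans (leq_addr _ _) ub.
  have /dvdnP[x Ex] : u %| e' - u.+1 * y by rewrite -eqn_mod_dvd // ye.
  have ux : u <= x by rewrite -(leq_pmul2r u0) -Ex leq_subRL.
  have -> : e' = u * x + u.+1 * y by rewrite mulnC -Ex subnK.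
  by rewrite expnD -mulnA; apply: reachable_mul => //; apply: reachable_mul.
elim/ltn_ind: z z0 => z IH z0; have [z1|z1] := leqP z 1.
  have -> : z = 1 by lia.
  by rewrite exp1n; split; [apply: HTD1|apply: TD1].
have pp := pdiv_prime z1; set p := pdiv z in pp.
have v0 : 0 < logn p z by rewrite logn_gt0 mem_primes pp z0 pdiv_dvd.
rewrite -(partnC p z0) expnMn p_part -expnM; apply: step => //.
apply: IH; last exact: part_gt0.
rewrite -[X in _ < X](partnC p z0) p_part ltn_Pmull ?part_gt0 //.
by rewrite -(expn0 p) ltn_exp2l // prime_gt1.
Qed.

Lemma HTD_power z e : 0 < z -> 3 * u ^ 2 + 2 * u <= e -> HTD k h (z ^ e).
Proof. by move=> z0 /(reachable_power z0)[]. Qed.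

End Powers.

(** * Long arithmetic progressions of admissible sizes *)

(** Bernoulli's inequality for [x / (x + 1)] with denominators cleared; truncated subtraction makes
    it trivial for [e > x]. *)
Lemma bernoulli_down x e : (x.+1 ^ e) * (x.+1 - e) <= x ^ e * x.+1.
Proof.
elim: e => [|e IH]; first by rewrite !expn0 subn0.
have [xe|ex] := leqP x.+1 e.+1; first by rewrite (eqP (xe : _ - _ == 0)) muln0.
have h : x.+1 * (x.+1 - e.+1) <= x * (x.+1 - e).
  by rewrite subSS subSn ?mulSn ?mulnS ?leq_add2r ?leq_subr //; apply: ltnW.
rewrite !expnS; move: (x.+1 ^ e) (x ^ e) (x.+1 - e.+1) (x.+1 - e) IH h => p p' s s' IH h.
have h1 : p * (x.+1 * s) <= p * (x * s') by rewrite leq_mul2l h orbT.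
have h2 : x * (p * s') <= x * (p' * x.+1) by rewrite leq_mul2l IH orbT.
lia.
Qed.

Lemma bernoulli_up x e : x ^ e * (x + e) <= x.+1 ^ e * x.
Proof.
elim: e => [|e IH]; first by rewrite !expn0 addn0.
rewrite !expnS; move: (x.+1 ^ e) (x ^ e) IH => p p' IH.
have h1 : p' * (x * (x + e.+1)) <= p' * (x.+1 * (x + e)) by rewrite leq_mul2l; nia.
have h2 : x.+1 * (p' * (x + e)) <= x.+1 * (p * x) by rewrite leq_mul2l IH orbT.
lia.
Qed.

(** The largest [z] with [z ^ E * A <= m] works: it is at least [E V], so passing to [z + 1] changes
    the [E]-th power only by a factor [1 / (1 - 1 / V)] at most. *)
Lemma tune E V A m : 0 < E -> 0 < V -> 0 < A -> A * (E * V) ^ E <= m ->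
  exists z, [/\ 0 < z, z ^ E * A <= m & m * (V - 1) <= V * (z ^ E * A)].
Proof.
move=> E0 V0 A0 mA.
have exP : exists z, z ^ E * A <= m by exists (E * V); rewrite mulnC.
have ubP z : z ^ E * A <= m -> z <= m.
  move=> h; apply: leq_trans h; case: z => // z.
  by apply: leq_trans (leq_pmulr _ A0); rewrite -{1}[z.+1]expn1 leq_pexp2l.
have [z zm zmax] := ex_maxnP exP ubP.
have zEV : E * V <= z by apply: zmax; rewrite mulnC.
have z0 : 0 < z by apply: leq_trans zEV; rewrite muln_gt0 E0.
have lt : m < z.+1 ^ E * A by rewrite ltnNge; apply/negP => /zmax; rewrite ltnn.
exists z; split=> //.
have b := bernoulli_down z E.
have h : m * (z.+1 - E) <= z ^ E * A * z.+1.
  apply: leq_trans (_ : z.+1 ^ E * A * (z.+1 - E) <= _); first by rewrite leq_mul2r ltnW ?orbT.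
  by rewrite mulnAC [X in _ <= X]mulnAC leq_mul2r b orbT.
rewrite -(@leq_pmul2r z.+1) //.
have h3 : V * (m * (z.+1 - E)) <= V * (z ^ E * A * z.+1) by rewrite leq_mul2l h orbT.
have h4 : (V - 1) * z.+1 <= V * (z.+1 - E).
  by rewrite mulnBl mul1n mulnBr; apply: leq_sub2l; rewrite mulnC ltnW // ltnS.
have h5 : m * ((V - 1) * z.+1) <= m * (V * (z.+1 - E)) by rewrite leq_mul2l h4 orbT.
rewrite -mulnA; apply: leq_trans h5 _; rewrite mulnCA; apply: leq_trans h3 _.
by rewrite mulnA.
Qed.

(* The constraint [d1 <= d0] is forced by [S_op] below, whose first weight is the smaller one. *)
Lemma two_digits g M d : 0 < g -> g <= M -> d < g * M - (g - 1) ^ 2 ->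
  exists d1 d0, [/\ d1 <= d0, d0 < M & d = (g - 1) * d1 + d0].
Proof.
case: g => // g _ gM; rewrite subn1 /= => dM.
have eg : g.+1 * M - g ^ 2 = g * (M - g) + M.
  by rewrite mulSn mulnBr mulnn addnC addnBAC // -mulnn leq_mul2l (ltnW gM) orbT.
rewrite eg in dM.
have dE := divn_eq d g.+1; have dl : d %% g.+1 < g.+1 by rewrite ltn_pmod.
(* Here [g] is one less than the base. The quotient and the quotient plus the remainder are the two
   digits, as long as the latter stays below [M]; beyond that [d1] is frozen at its largest
   value. *)
have [h|h] := leqP (d %/ g.+1) (M - g).
  exists (d %/ g.+1), (d %/ g.+1 + d %% g.+1); split; first exact: leq_addr.
    move: h dM dE dl; move: (d %/ _) (d %% _) => x y; rewrite leq_eqVlt => /orP[/eqP -> dM dE dl|]; lia.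
  by rewrite addnA -mulSnr mulnC.
exists (M - g), (d - g * (M - g)).
have h2 : g.+1 * (M - g) <= d by rewrite dE mulnC; apply: leq_trans (leq_addr _ _); rewrite leq_mul2r ltnW ?orbT.
rewrite mulSn in h2.
by split; lia.
Qed.

Lemma pow_quotient E x y : 1 < E -> 4 <= x -> x ^ E * E <= y * x -> 2 ^ E <= y.
Proof.
move=> E1 x4 h; have x0 : 0 < x by lia.
rewrite -(leq_pmul2r x0); apply: leq_trans h.
apply: leq_trans (_ : x ^ E * 1 <= _); last by rewrite leq_mul2l (ltnW E1) orbT.
rewrite muln1 -[in X in _ <= X](prednK (ltnW E1)) [x ^ _]expnS mulnC leq_mul2l; apply/orP; right.
apply: leq_trans (_ : 4 ^ E.-1 <= _); last by case: (E) E1 => [|[|e]] // _; rewrite leq_exp2r.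
by rewrite (_ : 4 = 2 ^ 2) // -expnM leq_exp2l //; lia.
Qed.

(** Meant for [L], [a], [b] the [E]-th powers of [x], [x + 1], [x + 2]: two Bernoulli steps keep
    [b / L] below [1 + 1 / P]. *)
Lemma two_bernoulli P E x a b L : (P + 1) * (2 * E + 1) <= x ->
  a * (x.+1 - E) <= L * x.+1 -> b * (x.+2 - E) <= a * x.+2 -> P * b <= (P + 1) * L.
Proof.
move=> Px d1 d2.
have Ex : E <= x by apply: leq_trans Px; rewrite mulnDl; lia.
have k0 : P * (x.+2 * x.+1) <= (P + 1) * ((x.+2 - E) * (x.+1 - E)).
  rewrite -(@leq_add2r ((P + 1) * (2 * E + 1) * x.+2)).
  apply: leq_trans (_ : P * (x.+2 * x.+1) + x * x.+2 <= _).
    by rewrite leq_add2l leq_mul2r Px orbT.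
  have -> : x.+2 - E = x - E + 2 by lia.
  have -> : x.+1 - E = x - E + 1 by lia.
  by rewrite -[x](subnKC Ex) addKn; move: (x - E) => y; nia.
have x0 : 0 < x.+2 * x.+1 by [].
rewrite -(leq_pmul2r x0).
apply: leq_trans (_ : b * ((P + 1) * ((x.+2 - E) * (x.+1 - E))) <= _).
  by rewrite mulnAC mulnC leq_mul2l k0 orbT.
have h1 : (P + 1) * (x.+1 - E) * (b * (x.+2 - E)) <= (P + 1) * (x.+1 - E) * (a * x.+2) by rewrite leq_mul2l d2 orbT.
have h2 : (P + 1) * x.+2 * (a * (x.+1 - E)) <= (P + 1) * x.+2 * (L * x.+1) by rewrite leq_mul2l d1 orbT.
by move: (x.+2 - E) (x.+1 - E) h1 h2 => u v; lia.
Qed.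

Lemma window_low V : 4 <= V -> V * (V + 2) <= (V + 4) * (V - 1).
Proof. by move=> /subnK <-; rewrite -addnBA //; lia. Qed.

Lemma window_high V : 4 <= V -> V * (V - 2) <= (V - 1) * (V - 1).
Proof. by move=> /subnK <-; rewrite -!addnBA //; lia. Qed.

Lemma window_lower q V : 6 <= q -> 4 <= V -> (q - 1) * (V - 1) + (V + 4) + 1 <= q * V.
Proof. by move=> /subnK <- /subnK <-; rewrite -!addnBA //; lia. Qed.

Lemma window_upper q V : 6 <= q -> 4 <= V ->
  q * V + 2 <= (q - 1) * (V - 2) + (V + 2) + 2 * (q - 1).
Proof. by move=> /subnK <- /subnK <-; rewrite -!addnBA //; lia. Qed.

(** * Growth of progressions under Wilson's operation *)

Section Numbers.

Variables (S : nat -> Prop) (E P : nat).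
Hypotheses (E0 : 0 < E) (P0 : 0 < P).
(** [S] stands for the numbers of holes that occur. The bounds [2 ^ E] provide transversal designs
    of orders [a] and [w], and [P * w <= a] the incomplete one. *)
Hypothesis S_power : forall z e, 0 < z -> E <= e -> S (z ^ e).
Hypothesis S_op : forall z e j a w, 0 < z -> E <= e -> j <= z ^ e ->
  j <= 1 \/ S j /\ (w = 0 \/ 2 ^ E <= w) ->
  S a -> S (a + w) -> 2 ^ E <= a -> P * w <= a -> S (z ^ e * a + j * w).

Lemma S_mul z e a : 0 < z -> E <= e -> S a -> 2 ^ E <= a -> S (z ^ e * a).
Proof.
move=> z0 Ee Sa a0; have := @S_op z e 0 a 0 z0 Ee (leq0n _) (or_introl isT) Sa.
by rewrite !addn0 muln0; apply.
Qed.

(** [2 ^ E <= U] makes the difference of two distinct terms an admissible [w]; the last clause makes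
    any two terms close enough for [S_op]. *)
Definition run A U M :=
  [/\ forall d, d < M -> S (A + U * d), 2 ^ E <= U, 0 < M & P * (U * M) <= A].

Lemma run_ge A U M : run A U M -> 2 ^ E <= A.
Proof.
case=> _ U0 M0; apply: leq_trans; apply: leq_trans U0 _.
by apply: leq_trans (leq_pmulr U M0) _; rewrite leq_pmull.
Qed.

Lemma run_step A U M z e g j : run A U M -> 0 < z -> E <= e -> z ^ e = g * j ->
  0 < j -> j <= 1 \/ S j -> 0 < g -> g <= M ->
  run (z ^ e * A) (j * U) (g * M - (g - 1) ^ 2).
Proof.
move=> HR z0 Ee zgj j0 Sj g0 gM; have A0 := run_ge HR; case: HR => HS U0 M0 PA.
have gsq : (g - 1) ^ 2 < g * M.
  apply: leq_trans (_ : g * g <= _); last by rewrite leq_mul2l gM orbT.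
  by rewrite mulnn ltn_exp2r // subn1 prednK.
split; last first.
- have h1 : P * (j * U) * (g * M - (g - 1) ^ 2) <= P * (j * U) * (g * M) by rewrite leq_mul2l leq_subr orbT.
  have h2 : g * j * (P * (U * M)) <= g * j * A by rewrite leq_mul2l PA orbT.
  by rewrite zgj; apply: leq_trans h2; rewrite mulnA; apply: leq_trans h1 _; apply: eq_leq; ring.
- by rewrite subn_gt0.
- by apply: leq_trans U0 _; rewrite leq_pmull.
move=> d /(two_digits g0 gM) [d1 [d0 [d10 d0M ->]]].
(* Since [z ^ e = g j], the terms with indices [d1 <= d0] combine to the index [(g - 1) d1 + d0] of
   a progression of step [j U]. *)
have -> : z ^ e * A + j * U * ((g - 1) * d1 + d0) = z ^ e * (A + U * d1) + j * (U * (d0 - d1)).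
  rewrite zgj; case: (g) g0 => // g' _; rewrite subn1 /=.
  rewrite -{1}(subnKC d10); move: (d0 - d1) => x; lia.
apply: S_op => //.
- by rewrite zgj leq_pmull.
- case: Sj => [|Sj]; [by left|right; split=> //].
  have [->|x0] := posnP (d0 - d1); first by left; rewrite muln0.
  by right; apply: leq_trans U0 _; rewrite leq_pmulr.
- by apply: HS; apply: leq_ltn_trans d0M.
- by rewrite -addnA -mulnDr subnKC //; apply: HS.
- by apply: leq_trans A0 (leq_addr _ _).
apply: leq_trans (leq_addr _ _); apply: leq_trans PA.
by rewrite !leq_mul2l (leq_trans (leq_subr _ _) (ltnW d0M)) !orbT.
Qed.

(** [R] says that the progression is not short compared with its size; each step doubles it, so it
    stays of moderate size throughout. *)
Definition good_run R A U M := run A U M /\ A <= R * (U * M).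

Lemma half_step g M : 0 < g -> 2 * g <= M + 2 -> g * M <= 2 * (g * M - (g - 1) ^ 2).
Proof.
case: g => // g _ gM; rewrite subn1 /=.
by have : 2 * g ^ 2 <= g.+1 * M; [rewrite -mulnn|]; nia.
Qed.

Lemma good_step R A U M b i : good_run R A U M -> 0 < b -> 2 * b ^ i <= M + 2 -> b ^ i <= M ->
  exists A', good_run (2 * R) A' (b ^ E * U) (b ^ i * M - (b ^ i - 1) ^ 2).
Proof.
move=> [HR AR] b0 bM bM'; exists (b ^ (i + E) * A).
have g0 : 0 < b ^ i by rewrite expn_gt0 b0.
have j0 : 0 < b ^ E by rewrite expn_gt0 b0.
split; first by apply: (run_step HR b0 _ (expnD _ _ _)) => //; [exact: leq_addl|right; exact: S_power].
have := half_step g0 bM; set M' := _ - _ => h.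
rewrite expnD; apply: leq_trans (leq_mul (leqnn _) AR) _.
rewrite [X in _ <= X](_ : _ = b ^ E * (R * U) * (2 * M')); last by lia.
rewrite [X in X <= _](_ : _ = b ^ E * (R * U) * (b ^ i * M)); last by lia.
by rewrite leq_mul2l h orbT.
Qed.

Lemma run_scale R A U M z : good_run R A U M -> 0 < z -> 2 * z ^ E <= M ->
  exists2 M', run (z ^ E * A) U M' & z ^ E * M <= 2 * M'.
Proof.
move=> [HR _] z0 zM; have g0 : 0 < z ^ E by rewrite expn_gt0 z0.
exists (z ^ E * M - (z ^ E - 1) ^ 2); last by apply: half_step => //; lia.
have := @run_step A U M z E (z ^ E) 1 HR z0 (leqnn _).
by rewrite muln1 mul1n; apply=> //; [left|lia].
Qed.

(** With [i] least such that [2 Y <= b ^ i], hence [b ^ i < 6 Y], one step multiplies the length by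
    at least [Y] and at most [6 Y], whereas [U] only gains [b ^ E]. *)
Lemma chain R A U M b r : good_run R A U M -> 1 < b <= 3 -> 24 <= M <= 56 ->
  exists A' M', [/\ good_run (2 ^ r * R) A' (b ^ (r * E) * U) M',
    12 * 2 ^ (2 ^ r) <= M' & M' <= 28 * 6 ^ r * 2 ^ (2 ^ r)].
Proof.
move=> HR /andP[b1 b3] /andP[M1 M2]; have b0 := ltnW b1.
elim: r => [|r [A' [M' [HR' h1 h2]]]].
  by exists A, M; rewrite !mul1n expn1 muln1; split.
set Y := 2 ^ (2 ^ r) in h1 h2.
have YS : 2 ^ (2 ^ r.+1) = Y * Y by rewrite expnS mul2n -addnn expnD.
have Y1 : 1 < Y by rewrite -(expn0 2) ltn_exp2l // expn_gt0.
have Y2 : 1 < 2 * Y by lia.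
have /andP[i1 i2] := up_log_bounds b1 Y2.
move: (up_log_gt0 b (2 * Y)); rewrite Y2 andbT b1 => i0.
set i := up_log b (2 * Y) in i1 i2 i0.
have g6 : b ^ i < 6 * Y.
  rewrite -(prednK i0) expnS; apply: leq_trans (_ : b * (2 * Y) <= _); first by rewrite ltn_pmul2l.
  by rewrite mulnA leq_mul2r; lia.
have [A'' HR''] := good_step HR' b0 (i := i) ltac:(lia) ltac:(lia).
exists A'', (b ^ i * M' - (b ^ i - 1) ^ 2); split.
- have -> : 2 ^ r.+1 * R = 2 * (2 ^ r * R) by rewrite expnS mulnA.
  by have -> : b ^ (r.+1 * E) * U = b ^ E * (b ^ (r * E) * U) by rewrite mulSn expnD mulnA.
- rewrite YS; have := @half_step (b ^ i) M' ltac:(lia) ltac:(lia).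
  have : 2 * Y * M' <= b ^ i * M' by rewrite leq_mul2r i2 orbT.
  have : 12 * Y * Y <= M' * Y by rewrite leq_mul2r h1 orbT.
  by move: (b ^ i * M' - _); lia.
- rewrite YS; apply: leq_trans (leq_subr _ _) _.
  apply: leq_trans (leq_mul (ltnW g6) h2) _; rewrite expnS; lia.
Qed.

Lemma good_steps n R A U M b : good_run R A U M -> 1 < b -> 2 * b <= M + 2 ->
  exists A', good_run (2 ^ n * R) A' (b ^ (n * E) * U) (iter n (fun M => b * M - (b - 1) ^ 2) M).
Proof.
move=> HR b1 bM; have b0 := ltnW b1; elim: n => [|n [A' IH]].
  by exists A; rewrite !mul1n.
have bMn : 2 * b <= iter n (fun M => b * M - (b - 1) ^ 2) M + 2.
  elim: n {IH} => //= n; move: (iter n _ _) => M' IH.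
  have : (b - 1) * (b - 1) <= (b - 1) * M' by rewrite leq_mul2l; lia.
  by rewrite -mulnn; nia.
have [A'' HR''] := good_step IH b0 (i := 1) ltac:(lia) ltac:(lia).
exists A''; have -> : 2 ^ n.+1 * R = 2 * (2 ^ n * R) by rewrite expnS mulnA.
by have -> : b ^ (n.+1 * E) * U = b ^ E * (b ^ (n * E) * U) by rewrite mulSn expnD mulnA.
Qed.

(** The window [[24, 56]] suits both uses: steps by one factor [b] give lengths 2, 3, 5, 9, 17, 33
    in base 2 and 4, 8, 20, 56 in base 3. *)
Lemma chain_from n R A U M b r : good_run R A U M -> 1 < b <= 3 -> 2 * b <= M + 2 ->
  24 <= iter n (fun M => b * M - (b - 1) ^ 2) M <= 56 ->
  exists A' M', [/\ good_run (2 ^ (r + n) * R) A' (b ^ ((r + n) * E) * U) M',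
    12 * 2 ^ (2 ^ r) <= M' & M' <= 28 * 6 ^ r * 2 ^ (2 ^ r)].
Proof.
move=> HR b13 bM nM; have /andP[b1 _] := b13.
have [A1 HR1] := good_steps n HR b1 bM.
have := chain r HR1 b13 nM.
by rewrite !mulnA -expnD -[b ^ _ * _ * U]/(b ^ _ * b ^ _ * U) -expnD -mulnDl.
Qed.

(** The product [(t (t + 1)) ^ E] times [t] and times [t + 1] are two products of high powers, hence
    a progression of length 2; [2 P <= t] makes its terms close. *)
Lemma chain_base2 t r : 1 < t -> 2 * P <= t ->
  exists A M, [/\ good_run (2 ^ (r + 5) * t) A (2 ^ ((r + 5) * E) * (t * t.+1) ^ E) M,
    12 * 2 ^ (2 ^ r) <= M & M <= 28 * 6 ^ r * 2 ^ (2 ^ r)].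
Proof.
move=> t1 Pt; have t0 := ltnW t1.
have tE0 e : 2 ^ E <= t ^ (E + e).
  apply: leq_trans (_ : t ^ E <= _); first by rewrite leq_exp2r.
  by rewrite leq_pexp2l // leq_addr.
have Sab e e' : S (t ^ (E + e) * t.+1 ^ (E + e')).
  rewrite mulnC; apply: S_mul => //; first exact: leq_addr.
  by apply: S_power => //; apply: leq_addr.
apply: (chain_from (n := 5) (A := t ^ (E + 1) * t.+1 ^ (E + 0)) (M := 2)) => //.
have e1 : t ^ (E + 1) * t.+1 ^ (E + 0) = t * (t * t.+1) ^ E by rewrite addn1 addn0 expnS expnMn mulnA.
split; last by rewrite e1 leq_mul2l leq_pmulr ?orbT.
split=> //.
- case=> [|[|//]] _; first by rewrite muln0 addn0; apply: Sab.
  rewrite muln1 (_ : _ + _ = t ^ (E + 0) * t.+1 ^ (E + 1)); first exact: Sab.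
  by rewrite e1 -mulSnr addn0 addn1 expnS expnMn; ring.
- by rewrite expnMn; have := tE0 0; rewrite addn0 => h; apply: leq_trans h (leq_pmulr _ _); rewrite expn_gt0.
rewrite e1; have := leq_mul Pt (leqnn ((t * t.+1) ^ E)); lia.
Qed.

(* In base 3 a progression of length 2 does not grow by itself; [x ^ E] provides translates of
   it lying below the multiples of the original one. *)
Lemma chain_base3 x r : 1 < E -> 4 <= x -> (P + 1) * (2 * E + 1) <= x ->
  exists A M, [/\ good_run (2 ^ (r + 3) * (3 * x.+1)) A
      (3 ^ ((r + 3) * E) * (3 ^ (2 * E) * (x.+2 ^ E - x.+1 ^ E))) M,
    12 * 2 ^ (2 ^ r) <= M & M <= 28 * 6 ^ r * 2 ^ (2 ^ r)].
Proof.
move=> E1 x4 Px; set L := x ^ E; set a := x.+1 ^ E; set b := x.+2 ^ E; set w := b - a.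
have La : L <= a by rewrite leq_exp2r.
have ab : a <= b by rewrite leq_exp2r.
have bE : b = a + w by rewrite subnKC.
have L2 : 2 ^ E <= L by rewrite leq_exp2r //; lia.
have [SL Sa Sb] : [/\ S L, S a & S b] by split; apply: S_power => //; lia.
have u1 : L * (x + E) <= a * x := bernoulli_up x E.
have u2 : a * (x.+1 + E) <= b * x.+1 := bernoulli_up x.+1 E.
have d1 : a * (x.+1 - E) <= L * x.+1 := bernoulli_down x E.
have d2 : b * (x.+2 - E) <= a * x.+2 := bernoulli_down x.+1 E.
have aL2 : 2 ^ E <= a - L.
  by apply: (pow_quotient E1 x4); move: u1; rewrite mulnBl mulnDr /L; lia.
have w2E : 2 ^ E <= w.
  apply: (@pow_quotient E x.+1 w E1 (leqW x4)).
  by move: u2; rewrite /w mulnBl mulnDr -/a; lia.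
have bL : P * b <= (P + 1) * L := two_bernoulli Px d1 d2.
have w2 : w < 2 * (a - L).
  have b2 : b <= 2 * L.
    have : P * b <= P * (2 * L).
      apply: leq_trans bL _; rewrite mulnCA mulnA leq_mul2r; apply/orP; right; lia.
    by rewrite leq_pmul2l.
  have h1 : w * x.+2 <= b * E by move: d2; rewrite mulnBr /w mulnBl; lia.
  have h2 : L * E <= (a - L) * x by move: u1; rewrite mulnBl mulnDr; lia.
  have h3 : b * E <= 2 * L * E by rewrite leq_mul2r b2 orbT.
  have h4 : (a - L) * x < (a - L) * x.+2.
    by rewrite ltn_pmul2l //; apply: leq_trans aL2; rewrite expn_gt0.
  by rewrite -(@ltn_pmul2r x.+2) //; lia.
have Pw y : y <= b - L -> P * y <= L.
  move=> h; apply: leq_trans (_ : P * (b - L) <= _); first by rewrite leq_mul2l h orbT.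
  by rewrite mulnBr leq_subLR; move: bL; rewrite mulnDl mul1n.
have wa : a <= x.+1 * w.
  by move: u2; rewrite bE mulnDr mulnDl; have := leq_pmulr a E0; lia.
have w0 : 0 < w by rewrite lt0n; apply/eqP => w0; move: wa; rewrite w0 muln0; lia.
have S1 d : d < 2 -> S (3 ^ E.+1 * L + 3 ^ E * (a - L + w * d)).
  move=> d2'; have h : a - L + w * d <= b - L by case: d d2' => [|[|//]] _; lia.
  apply: S_op => //; first by rewrite leq_exp2l.
  - right; split; first exact: S_power.
    by right; apply: leq_trans aL2 (leq_addr _ _).
  - have -> : L + (a - L + w * d) = a + w * d by rewrite addnA subnKC.
    by case: d d2' {h} => [|[|//]] _; rewrite ?muln0 ?muln1 ?addn0 // -bE.
  - exact: Pw.
have S0 d : d < 2 -> S (3 ^ E.+1 * a + 3 ^ E * (w * d)).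
  move=> d2'; have h : w * d <= b - L by case: d d2' => [|[|//]] _; lia.
  case: d d2' h => [|[|//]] _ h.
    by rewrite muln0 muln0 addn0; apply: S_mul => //; apply: leq_trans L2 La.
  apply: S_op => //; first by rewrite leq_exp2l.
  - right; split; first exact: S_power.
    by right; rewrite muln1.
  - by rewrite muln1 -bE.
  - exact: leq_trans L2 La.
  - by apply: leq_trans La; apply: Pw.
set T := 3 ^ E in S1 S0 *.
have T0 : 0 < T by rewrite expn_gt0.
have T2 : 2 ^ E <= T by rewrite leq_exp2r.
have T3 : 3 ^ E.+1 = 3 * T by rewrite expnS.
have TT : 3 ^ (2 * E) = T * T by rewrite mul2n -addnn expnD.
rewrite TT T3 in S1 S0 *.
apply: (chain_from (n := 3) (A := T * T * (4 * L + 5 * a)) (M := 4)) => //.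
(* The lower term comes from [S1], the upper one from [S0], and [w < 2 (a - L)] keeps their
   difference [T v] positive. In the combination [w] has coefficient
   [3 d1' + d0' - d1' = 2 d1' + d0'], which takes the values 0 to 3. *)
have key d1' d0' : d1' < 2 -> d0' < 2 -> S (T * T * (4 * L + 5 * a) + T * T * w * (2 * d1' + d0')).
  move=> hd1 hd0.
  pose v := 2 * (a - L) + w * d0' - w * d1'.
  have wd1 : w * d1' <= w by case: d1' hd1 {v} => [|[|//]] _; lia.
  have v0 : 0 < v by rewrite /v; lia.
  have vE : 3 * L + (a - L + w * d1') + v = 3 * a + w * d0' by rewrite /v; lia.
  have -> : T * T * (4 * L + 5 * a) + T * T * w * (2 * d1' + d0')
     = 3 ^ E.+1 * (3 * T * L + T * (a - L + w * d1')) + T * (T * v).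
    rewrite T3.
    have : T * T * (3 * L + (a - L + w * d1') + v) = T * T * (3 * a + w * d0') by rewrite vE.
    have : T * T * (a - L) + T * T * L = T * T * a by rewrite -mulnDr subnK.
    by rewrite !mulnDr; lia.
  apply: S_op => //; first by rewrite T3 leq_pmull.
  - right; split; first exact: S_power.
    by right; apply: leq_trans T2 (leq_pmulr _ v0).
  - exact: S1.
  - have -> : 3 * T * L + T * (a - L + w * d1') + T * v = 3 * T * a + T * (w * d0'); last exact: S0.
    have : T * (3 * L + (a - L + w * d1') + v) = T * (3 * a + w * d0') by rewrite vE.
    by rewrite !mulnDr; lia.
  - apply: leq_trans L2 _; apply: leq_trans (leq_addr _ _); rewrite leq_pmull // muln_gt0 T0 //.
  have vb : v <= 3 * (b - L).
    have : w * d0' <= w by case: d0' hd0 {v v0 vE} => [|[|//]] _; lia.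
    by rewrite /v; lia.
  apply: leq_trans (leq_addr _ _).
  have := Pw (b - L) (leqnn _) => h.
  have h2 : P * v <= P * (3 * (b - L)) by rewrite leq_mul2l vb orbT.
  have h3 : T * (P * v) <= T * (3 * L) by rewrite leq_mul2l; apply/orP; right; lia.
  by lia.
split; last first.
  have h : T * T * a <= T * T * (x.+1 * w) by rewrite leq_mul2l wa orbT.
  have h' : T * T * L <= T * T * a by rewrite leq_mul2l La orbT.
  by rewrite mulnDr; lia.
split=> //.
- case=> [|[|[|[|//]]]] _; [exact: (key 0 0)|exact: (key 0 1)|exact: (key 1 0)|exact: (key 1 1)].
- apply: leq_trans T2 _; rewrite -mulnA leq_pmulr // muln_gt0 T0 w0 //.
have h : P * w <= L by apply: Pw; lia.
have h' : T * T * (P * w) <= T * T * L by rewrite leq_mul2l h orbT.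
by rewrite mulnDr; lia.
Qed.

(* [n = (q - 1) x1 + x0], with [x1] and [x0] in two progressions of coprime steps. *)
Lemma combine R A1 U1 M1 A2 U2 M2 zq e V mu n (q := zq ^ e) :
  good_run R A1 U1 M1 -> good_run R A2 U2 M2 -> 0 < zq -> E <= e -> 6 <= q ->
  coprime ((q - 1) * U2) U1 -> 4 * R + 2 < V -> 7 * P + 2 <= V -> 4 <= V ->
  q * V * mu <= n -> n <= q * V * mu + q * V -> q * V <= 2 * mu ->
  A1 * (E * V) ^ E <= mu -> A2 * (E * V) ^ E <= mu ->
  2 * ((V + 4) * mu) <= A1 * M1 -> 2 * ((V + 4) * mu) <= A2 * M2 ->
  q * U2 * U1 <= mu -> 2 * (q * U2) <= M1 -> S n.
Proof.
move=> G1 G2 zq0 Ee q6 cop VR VP V4 n1 n2 qV h1 h2 h3 h4 h5 h6.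
have A1_0 : 0 < A1 by apply: leq_trans (run_ge G1.1); rewrite expn_gt0.
have A2_0 : 0 < A2 by apply: leq_trans (run_ge G2.1); rewrite expn_gt0.
have V0 : 0 < V by lia.
have [[_ U10 M10 _] _] := G1; have [[_ U20 M20 _] AR2] := G2.
have {}U10 : 0 < U1 by apply: leq_trans U10; rewrite expn_gt0.
have {}U20 : 0 < U2 by apply: leq_trans U20; rewrite expn_gt0.
have h1' : A1 * (E * V) ^ E <= (V + 4) * mu by apply: leq_trans h1 _; rewrite leq_pmull // addnS.
have h2' : A2 * (E * V) ^ E <= (V - 1) * mu by apply: leq_trans h2 _; rewrite leq_pmull //; lia.
(* Rescaling puts [B1] in [[(V + 2) mu, (V + 4) mu]] and [B2] in [[(V - 2) mu, (V - 1) mu]], so that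
   [B2 + 2 mu] is still below [B1] and [x1 <= x0] holds below. *)
have [z1 [z10 B1u B1l]] := tune E0 V0 A1_0 h1'.
have [z2 [z20 B2u B2l]] := tune E0 V0 A2_0 h2'.
have [M1' R1 M1z] : exists2 M', run (z1 ^ E * A1) U1 M' & z1 ^ E * M1 <= 2 * M'.
  apply: (run_scale G1) => //; rewrite -(leq_pmul2r A1_0) [M1 * _]mulnC; apply: leq_trans h3.
  by rewrite -mulnA leq_mul2l B1u.
have [M2' R2 M2z] : exists2 M', run (z2 ^ E * A2) U2 M' & z2 ^ E * M2 <= 2 * M'.
  apply: (run_scale G2) => //; rewrite -(leq_pmul2r A2_0) [M2 * _]mulnC; apply: leq_trans h4.
  rewrite -mulnA leq_mul2l; apply: leq_trans B2u _; rewrite leq_mul2r; lia.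
have RB2 : z2 ^ E * A2 <= 2 * R * (U2 * M2').
  have := leq_mul (leqnn (z2 ^ E)) AR2.
  have := leq_mul (leqnn (R * U2)) M2z; lia.
set B1 := z1 ^ E * A1 in B1u B1l R1; set B2 := z2 ^ E * A2 in B2u B2l R2 RB2.
have {}B1l : (V + 2) * mu <= B1.
  rewrite -(leq_pmul2l V0); apply: leq_trans B1l; rewrite mulnA [X in _ <= X]mulnAC leq_mul2r window_low ?orbT //.
have {}B2l : (V - 2) * mu <= B2.
  rewrite -(leq_pmul2l V0); apply: leq_trans B2l; rewrite mulnA [X in _ <= X]mulnAC leq_mul2r window_high ?orbT //.
have M1q : (q - 1) * U2 <= M1'.
  have := leq_mul (leq_trans (isT : 0 < 1) (_ : 1 <= z1 ^ E)) (leqnn M1); rewrite expn_gt0 z10 => /(_ isT).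
  by rewrite mulnBl; lia.
have q1 : 0 < q - 1 by lia.
have [N0 [nE N1 N2]] : exists N0, [/\ n = (q - 1) * B2 + B1 + N0, mu <= N0 & N0 <= 2 * (q - 1) * mu].
  exists (n - ((q - 1) * B2 + B1)).
  have g1 : (q - 1) * B2 <= (q - 1) * ((V - 1) * mu) by rewrite leq_mul2l B2u orbT.
  have g2 : (q - 1) * ((V - 2) * mu) <= (q - 1) * B2 by rewrite leq_mul2l B2l orbT.
  have g3 : (q - 1) * ((V - 1) * mu) + (V + 4) * mu + mu <= q * V * mu.
    rewrite mulnA -mulnDl -[X in _ + X <= _]mul1n -mulnDl leq_mul2r; apply/orP; right.
    exact: window_lower.
  have g4 : q * V * mu + 2 * mu <= (q - 1) * ((V - 2) * mu) + (V + 2) * mu + 2 * (q - 1) * mu.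
    rewrite mulnA -!mulnDl leq_mul2r; apply/orP; right.
    exact: window_upper.
  by split; lia.
have a0 : 0 < (q - 1) * U2 by rewrite muln_gt0 q1.
(* [d0] is reduced modulo [(q - 1) * U2], hence below [M1']. Then [d1] is forced; it is below [M2']
   because [U2 d1 <= 2 mu], [4 R + 2 < V] and [R] controls the second progression. *)
have [d0 [_ d0l]] := coprime_solve N0 0 a0 cop; rewrite add0n in d0l => d0E.
have d0N : U1 * d0 <= N0.
  apply: leq_trans N1; apply: leq_trans h5; rewrite mulnC leq_mul2r; apply/orP; right.
  by apply: ltnW; apply: leq_trans d0l _; rewrite leq_mul2r; lia.
have /dvdnP[d1 Ed1] : (q - 1) * U2 %| N0 - U1 * d0 by rewrite -eqn_mod_dvd // d0E.
have NE : N0 = (q - 1) * (U2 * d1) + U1 * d0 by rewrite -(subnK d0N) Ed1; lia.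
have Ud1 : U2 * d1 <= 2 * mu.
  rewrite -(leq_pmul2l q1); apply: (@leq_trans (2 * (q - 1) * mu)).
    by apply: leq_trans N2; rewrite NE leq_addr.
  by rewrite mulnCA mulnA.
have d1M : d1 < M2'.
  rewrite -(ltn_pmul2l U20); apply: leq_ltn_trans Ud1 _.
  have R0 : 0 < 2 * R.
    by rewrite lt0n; apply/eqP => R00; move: RB2; rewrite R00 mul0n leqn0 muln_eq0 expn_eq0 eqn0Ngt z20 eqn0Ngt A2_0.
  rewrite -(ltn_pmul2l R0); apply: leq_trans RB2; apply: leq_trans B2l.
  have mu0 : 0 < mu by apply: leq_trans h5; rewrite !muln_gt0 U10 U20 !andbT; lia.
  by rewrite mulnA ltn_pmul2r //; lia.
have [x1 x1E] : exists x1, x1 = B2 + U2 * d1 by eexists.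
have [x0 x0E] : exists x0, x0 = B1 + U1 * d0 by eexists.
have Ub : U1 * d0 <= mu by apply: leq_trans h5; rewrite mulnC leq_mul2r; apply/orP; right; apply: ltnW; apply: leq_trans d0l _; rewrite leq_mul2r; lia.
have x10 : x1 <= x0 by rewrite x1E x0E; move: B2u B1l; rewrite mulnBl mulnDl; lia.
have Sx1 : S x1 by rewrite x1E; case: R2 => HS _ _ _; apply: HS.
have Sx0 : S x0 by rewrite x0E; case: R1 => HS _ _ _; apply: HS; apply: leq_trans d0l M1q.
have -> : n = zq ^ e * x1 + 1 * (x0 - x1).
  rewrite -/q mul1n -(subnK (ltnW (ltnW (ltnW (ltnW (ltnW q6)))))) [in RHS]mulnDl mul1n.
  by rewrite -addnA (subnKC x10) nE NE x1E x0E; ring.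
apply: S_op => //.
- by rewrite -/q; lia.
- by left.
- by rewrite subnKC.
- by rewrite x1E; apply: leq_trans (run_ge R2) (leq_addr _ _).
(* [x0 - x1 <= (V + 4) mu + mu - (V - 2) mu = 7 mu], whence the condition [7 * P + 2 <= V]. *)
apply: leq_trans (_ : P * (7 * mu) <= _).
  rewrite leq_mul2l x0E x1E; apply/orP; right.
  by move: B2l B1u; rewrite mulnBl mulnDl; lia.
apply: leq_trans (_ : (V - 2) * mu <= _); last by rewrite x1E; apply: leq_trans B2l (leq_addr _ _).
by rewrite mulnA leq_mul2r; lia.
Qed.

End Numbers.

(** * Two coprime chains and all large integers *)

Lemma coprime_pow_diff t E : 0 < E -> coprime (t.+1 ^ E - t ^ E) (t * t.+1).
Proof.
move=> E0; have le : t ^ E <= t.+1 ^ E by rewrite leq_exp2r.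
have c : coprime t.+1 (t ^ E) by rewrite coprimeXr // coprimeSn.
have c' : coprime t (t.+1 ^ E) by rewrite coprimeXr // coprimenS.
rewrite coprimeMr; apply/andP; split; rewrite coprime_sym /coprime -dvdn1.
  rewrite -(eqP c') dvdn_gcd dvdn_gcdl /= -[X in _ %| X](subnK le).
  rewrite dvdn_add ?dvdn_gcdr //; apply: dvdn_trans (dvdn_gcdl _ _) _; exact: dvdn_exp.
rewrite -(eqP c) dvdn_gcd dvdn_gcdl /=.
have := dvdn_gcdr t.+1 (t.+1 ^ E - t ^ E); rewrite dvdn_subr //.
by apply: dvdn_trans (dvdn_gcdl _ _) _; apply: dvdn_exp.
Qed.

Lemma leq_2pow a b : a <= b -> 2 ^ a <= 2 ^ b.
Proof. by move=> ab; rewrite leq_exp2l. Qed.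

Lemma good_run_le S E P R R' A U M : R <= R' -> good_run S E P R A U M -> good_run S E P R' A U M.
Proof. by move=> RR' [HR AR]; split=> //; apply: leq_trans AR _; rewrite leq_mul2r RR' orbT. Qed.

Lemma pow3_le e : 3 ^ e <= 2 ^ (2 * e).
Proof. by case: e => // e; rewrite expnM leq_exp2r. Qed.

Lemma large_bounds l E W r : 1 < E -> E <= 2 ^ l -> W = 8 * l + 70 -> r = up_log 2 (11 * (E * W)) ->
  [/\ r <= 2 * l + 10, 11 * (E * W) <= 2 ^ r & 2 ^ r <= 22 * (E * W)].
Proof.
move=> E1 El WE rE; have H1 : 1 < 11 * (E * W).
  by rewrite WE; apply: leq_trans (_ : 11 * (E * 1) <= _); [lia|rewrite !leq_mul2l; lia].
have /andP[h1 h2] := up_log_bounds (isT : 1 < 2) H1.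
have r0 : 0 < up_log 2 (11 * (E * W)) by rewrite up_log_gt0.
rewrite -rE in h1 h2 r0.
have h3 : 2 ^ r <= 22 * (E * W) by rewrite -(prednK r0) expnS; lia.
split=> //.
have : r.-1 < 2 * l + 10; last by lia.
have : 2 ^ r.-1 < 2 ^ (2 * l + 10).
  apply: leq_trans h1 _; have lW : 11 * W <= 2 ^ (l + 10).
    have ll : l < 2 ^ l by rewrite ltn_expl.
    by rewrite expnD WE -[2 ^ 10]/1024; lia.
  rewrite mulnCA; apply: leq_trans (leq_mul El lW) _.
  by rewrite -expnD leq_2pow //; lia.
by rewrite ltn_exp2l.
Qed.

Lemma exponent_bounds l E W r : 1 < E -> W = 8 * l + 70 -> r <= 2 * l + 10 ->
  [/\ (4 * l + 9) * E <= 1 * (E * W), (r + 5) * E + (4 * l + 9) * E <= 1 * (E * W),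
      2 * ((r + 3) * E + 2 * E) + (2 * l + 5) * E <= 1 * (E * W) & 4 * l + 25 <= 1 * (E * W)] /\
  [/\ (4 * l + 9) * E + (4 * l + 23) <= 1 * (E * W), (5 * l + 23) * E <= 1 * (E * W),
      4 * l + 19 + (5 + 3 * r) <= 1 * (E * W), E <= 1 * (E * W) & l + E <= 2 * (E * W)].
Proof.
move=> E1 WE rl; have EW : E * W = 8 * (E * l) + 70 * E by rewrite WE; lia.
have lEl : 2 * l <= E * l by rewrite leq_mul2r E1 orbT.
have rEl : r * E <= 2 * (E * l) + 10 * E by have := leq_mul rl (leqnn E); lia.
by split; split; lia.
Qed.

Lemma base_bounds l E P t : 1 < E -> 0 < P -> E <= 2 ^ l -> P <= 2 ^ l -> t = 2 ^ (2 * l + 4) ->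
  [/\ t.+1 <= 2 ^ (2 * l + 5), 2 * P <= t, (P + 1) * (2 * E + 1) <= t.-1, 4 <= t.-1 & 1 < t].
Proof.
move=> E1 P0 El Pl tE; have E0 := ltnW E1.
have t16 : t = 16 * (2 ^ l * 2 ^ l) by rewrite tE expnD mul2n -addnn expnD mulnC.
have tS : 2 ^ (2 * l + 5) = 2 * t by rewrite addnS expnS tE.
have EP : E * P <= 2 ^ l * 2 ^ l by apply: leq_mul.
have h1 := leq_pmull P E0; have h2 := leq_pmulr E P0.
move: (2 ^ l * 2 ^ l) EP t16 => x EP t16.
by split; rewrite ?tS; lia.
Qed.

Theorem all_large (S : nat -> Prop) E P l : 1 < E -> 0 < P -> E <= 2 ^ l -> P <= 2 ^ l ->
  (forall z e, 0 < z -> E <= e -> S (z ^ e)) ->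
  (forall z e j a w, 0 < z -> E <= e -> j <= z ^ e ->
    j <= 1 \/ S j /\ (w = 0 \/ 2 ^ E <= w) ->
    S a -> S (a + w) -> 2 ^ E <= a -> P * w <= a -> S (z ^ e * a + j * w)) ->
  forall n, 2 ^ (28 * (E * (8 * l + 70))) <= n -> S n.
Proof.
move=> E1 P0 El Pl S_power S_op; have E0 := ltnW E1.
have [W WE] : exists W, W = 8 * l + 70 by eexists.
have [r rE] : exists r, r = up_log 2 (11 * (E * W)) by eexists.
have [rl Wr rW] := large_bounds E1 El WE rE.
rewrite -WE.
(* Sizes are counted in powers of [2 ^ (E W)]: [U1], [U2], [q V] and [(E V) ^ E] are at most
   [Phi 1], whereas both lengths exceed [Y], which is at least [Phi 11]. *)
pose Phi e := 2 ^ (e * (E * W)); pose Y := 2 ^ (2 ^ r).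
have PhiM e e' : Phi e * Phi e' = Phi (e + e') by rewrite /Phi -expnD mulnDl.
have Phi_le e e' : e <= e' -> Phi e <= Phi e' by move=> h; rewrite leq_2pow // leq_mul2r h orbT.
have PhiY : Phi 11 <= Y by apply: leq_2pow.
have [[x1 x2 x3 x5] [x6 x7 x8 x9 x10]] := exponent_bounds E1 WE rl.
have [t tE] : exists t, t = 2 ^ (2 * l + 4) by eexists.
have [tl Pt Ex x4 t1] := base_bounds E1 P0 El Pl tE.
have [A1 [M1 [G1 M1l M1u]]] := chain_base2 E0 P0 S_power S_op r t1 Pt.
have [A2 [M2 [G2 M2l M2u]]] := chain_base3 E0 P0 S_power S_op r E1 x4 Ex.
rewrite (ltn_predK t1) in G2.
set U1 := 2 ^ ((r + 5) * E) * _ in G1; set U2 := 3 ^ _ * _ in G2.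
pose R := 2 ^ (4 * l + 19).
have r1 : r + 5 + (2 * l + 4) <= 4 * l + 19 by clear - rl; lia.
have r2 : r + 3 + (2 + (2 * l + 4)) <= 4 * l + 19 by clear - rl; lia.
have {}G1 : good_run S E P R A1 U1 M1.
  by apply: (good_run_le _ G1); rewrite tE -expnD leq_2pow.
have {}G2 : good_run S E P R A2 U2 M2.
  apply: (good_run_le _ G2); apply: leq_trans (_ : 2 ^ (r + 3) * (2 ^ 2 * t) <= _).
    by rewrite leq_mul2l leq_mul2r; apply/orP; right; apply/orP; right.
  by rewrite tE -!expnD leq_2pow.
pose q := (t * t.+1) ^ E; pose V := 2 ^ (4 * l + 23).
have ttl : t * t.+1 <= 2 ^ (4 * l + 9).
  apply: leq_trans (leq_mul (leqnn t) tl) _; rewrite tE -expnD leq_2pow //.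
  by clear; lia.
have qle : q <= 2 ^ ((4 * l + 9) * E) by rewrite /q expnM leq_exp2r.
have q1 : q <= Phi 1 by apply: leq_trans qle _; apply: leq_2pow.
have U1l : U1 <= Phi 1.
  apply: leq_trans (leq_mul (leqnn _) qle) _; rewrite -expnD; exact: leq_2pow.
have U2l : U2 <= Phi 1.
  rewrite /U2 mulnA -expnD; apply: leq_trans (_ : 2 ^ (2 * ((r + 3) * E + 2 * E)) * 2 ^ ((2 * l + 5) * E) <= _).
    apply: leq_mul; first exact: pow3_le.
    by apply: leq_trans (leq_subr _ _) _; rewrite expnM leq_exp2r.
  by rewrite -expnD; apply: leq_2pow.
have V0 : 4 <= V by rewrite /V -[4]/(2 ^ 2) leq_2pow //; clear; lia.
have Vl : 2 * (V + 4) <= Phi 1.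
  apply: leq_trans (_ : 2 ^ (4 * l + 25) <= _); last exact: leq_2pow.
  have -> : 4 * l + 25 = 2 + (4 * l + 23) by clear; lia.
  by rewrite expnD -/V -[2 ^ 2]/4; move: V V0; clear; lia.
have qV : q * V <= Phi 1.
  by apply: leq_trans (leq_mul qle (leqnn V)) _; rewrite -expnD; apply: leq_2pow.
have EV : (E * V) ^ E <= Phi 1.
  apply: leq_trans (_ : (2 ^ (5 * l + 23)) ^ E <= _); last by rewrite -expnM; apply: leq_2pow.
  have -> : 5 * l + 23 = l + (4 * l + 23) by clear; lia.
  by rewrite leq_exp2r // expnD leq_mul2r El orbT.
have RM M : M <= 28 * 6 ^ r * Y -> R * M <= Phi 1 * Y.
  move=> h; apply: leq_trans (leq_mul (leqnn R) h) _; rewrite mulnA leq_mul2r; apply/orP; right.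
  have h6 : 28 * 6 ^ r <= 2 ^ (5 + 3 * r).
    by rewrite expnD expnM leq_mul //; case: (r) => // r'; rewrite leq_exp2r.
  by apply: leq_trans (leq_mul (leqnn R) h6) _; rewrite -expnD; apply: leq_2pow.
have Al A U M : good_run S E P R A U M -> U <= Phi 1 -> M <= 28 * 6 ^ r * Y -> A <= Phi 2 * Y.
  move=> [_ h] hU /RM hM; apply: leq_trans h _; rewrite mulnCA.
  by apply: leq_trans (leq_mul hU hM) _; rewrite mulnA PhiM.
have MA A U M : good_run S E P R A U M -> 12 * Y <= M -> Y * Y <= A * M.
  move=> [[_ U0 M0 hA] _] hM; apply: leq_mul; last by apply: leq_trans hM; rewrite leq_pmull.
  apply: leq_trans hA; apply: leq_trans (_ : M <= _); first by apply: leq_trans hM; rewrite leq_pmull.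
  have U0' : 0 < U by apply: leq_trans U0; rewrite expn_gt0.
  by apply: leq_trans (leq_pmull _ P0); rewrite leq_pmull.
have q6 : 6 <= q.
  apply: leq_trans (_ : t ^ 1 <= _).
    by rewrite expn1 tE -[6]/(6 : nat); apply: leq_trans (_ : 2 ^ 4 <= _) => //; rewrite leq_2pow // leq_addl.
  by apply: leq_trans (leq_pexp2l (ltnW t1) E0) _; rewrite leq_exp2r // leq_pmulr.
(* The exponent [2 l + 4] is even, so 3 divides neither [t] nor [t + 1]. *)
have mod3 : t %% 3 = 1 
  by rewrite tE -[4]/(2 * 2) -mulnDr expnM -modnXm exp1n.
have cop : coprime ((q - 1) * U2) U1.
  have tt2 : 2 %| t * t.+1 by rewrite dvdn_mulr // tE addnS expnS dvdn_mulr.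
  suff : coprime ((q - 1) * U2) (t * t.+1).
    move=> h; rewrite /U1 coprimeMr; apply/andP; split; last by rewrite coprimeXr.
    by rewrite coprimeXr // (coprime_dvdr tt2 h).
  rewrite !coprimeMl; apply/and4P; split.
  - have : coprime (q - 1) q by rewrite subn1 coprime_sym coprimenP // (leq_trans _ q6).
    by apply: coprime_dvdr; rewrite /q dvdn_exp.
  - rewrite coprimeXl // coprimeMr !prime_coprime // /dvdn -[t.+1]addn1 -[(t + 1) %% 3]modnDml.
    by rewrite mod3.
  - rewrite coprimeXl // coprimeMr !prime_coprime // /dvdn -[t.+1]addn1 -[(t + 1) %% 3]modnDml.
    by rewrite mod3.
  - exact: coprime_pow_diff.
have base n : Phi 6 * Y <= n -> n <= Phi 10 * Y -> S n.
  move=> n1 n2; pose mu := n %/ (q * V).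
  have qV0 : 0 < q * V by rewrite muln_gt0 (leq_trans _ q6) // (leq_trans _ V0).
  have mu5 : Phi 5 * Y <= mu.
    rewrite leq_divRL //; apply: leq_trans n1; rewrite mulnAC leq_mul2r; apply/orP; right.
    by apply: leq_trans (leq_mul (leqnn _) qV) _; rewrite PhiM.
  have muY : 2 * ((V + 4) * mu) <= Y * Y.
    rewrite mulnA; apply: leq_trans (leq_mul Vl (leq_trans (leq_div _ _) n2)) _.
    by rewrite mulnA PhiM leq_mul2r PhiY orbT.
  have Y1 : 0 < Y by rewrite expn_gt0.
  have Phi5 e : e <= 5 -> Phi e <= mu.
    by move=> h; apply: leq_trans mu5; apply: leq_trans (Phi_le _ _ h) _; rewrite leq_pmulr.
  have Amu A : A <= Phi 2 * Y -> A * (E * V) ^ E <= mu.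
    move=> h; apply: leq_trans (leq_mul h EV) _; rewrite mulnAC PhiM; apply: leq_trans mu5.
    by rewrite leq_mul2r Phi_le ?orbT.
  apply: (@combine S E P E0 P0 S_op R A1 U1 M1 A2 U2 M2 (t * t.+1) E V mu n) => //.
  - by rewrite muln_gt0 (ltnW t1).
  - rewrite /V /R; clear; have -> : 4 * l + 23 = 4 + (4 * l + 19) by lia.
    by rewrite [2 ^ (4 + _)]expnD; have := expn_gt0 2 (4 * l + 19); lia.
  - apply: leq_trans (_ : 2 ^ l * 16 <= _).
      by have := expn_gt0 2 l; clear - Pl; lia.
    by rewrite -[16]/(2 ^ 4) -expnD leq_2pow //; clear; lia.
  - by rewrite mulnC leq_trunc_div.
  - by rewrite [_ * mu]mulnC -mulSnr ltnW // ltn_ceil.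
  - by apply: leq_trans qV _; apply: leq_trans (Phi5 1 _) _ => //; rewrite leq_pmull.
  - by apply: Amu; apply: Al G1 _ _.
  - by apply: Amu; apply: Al G2 _ _.
  - by apply: leq_trans muY (MA _ _ _ G1 _).
  - by apply: leq_trans muY (MA _ _ _ G2 _).
  - apply: leq_trans (leq_mul (leq_mul q1 U2l) U1l) _; rewrite !PhiM; exact: Phi5.
  - apply: leq_trans (leq_trans PhiY (leq_trans _ M1l)); last by rewrite leq_pmull.
    have P2 : 2 <= Phi 1 by apply: leq_trans Vl; rewrite leq_pmulr // addnS.
    apply: leq_trans (leq_mul P2 (leq_mul q1 U2l)) _; rewrite !PhiM; exact: Phi_le.
(* [28 = 6 + 22], as [Y = 2 ^ (2 ^ r)] with [2 ^ r <= 22 E W]. *)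
move=> n n0; have {n0} : Phi 6 * Y <= n.
  by apply: leq_trans n0; rewrite -expnD; apply: leq_2pow; clear - rW; lia.
elim/ltn_ind: n => n IH n1.
have [n2|n2] := leqP n (Phi 10 * Y); first exact: base.
(* Both [a] and [a + w] are below [n] and, as [n > Phi 10 * Y], still above [Phi 6 * Y]; here
   [j = 1], so the remainder [w] may be small. *)
pose a := n %/ 2 ^ E; pose w := n %% 2 ^ E.
have nE : n = 2 ^ E * a + 1 * w by rewrite mul1n mulnC -divn_eq.
have E2 : 2 ^ E <= Phi 1 by apply: leq_2pow.
have a1 : Phi 6 * Y <= a.
  rewrite leq_divRL ?expn_gt0 //; apply: leq_trans (ltnW n2); rewrite mulnAC leq_mul2r; apply/orP; right.
  by apply: leq_trans (leq_mul (leqnn _) E2) _; rewrite PhiM Phi_le.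
have Y1 : 0 < Y by rewrite expn_gt0.
have aPhi : Phi 2 <= a by apply: leq_trans a1; apply: leq_trans (Phi_le 2 6 isT) _; rewrite leq_pmulr.
have a0 : 0 < a by apply: leq_trans aPhi; rewrite expn_gt0.
have E22 : 2 <= 2 ^ E by rewrite -{1}[2]expn1 leq_exp2l.
have aw : a + w < n.
  by rewrite [X in _ < X]nE mul1n ltn_add2r -[X in X < _]mul1n ltn_pmul2r.
rewrite nE; apply: S_op => //.
- by rewrite expn_gt0.
- by left.
- by apply: IH => //; apply: leq_ltn_trans aw; rewrite leq_addr.
- by apply: IH => //; apply: leq_trans a1 (leq_addr _ _).
- by apply: leq_trans aPhi; apply: leq_trans E2 _; apply: Phi_le.
apply: leq_trans (_ : 2 ^ l * 2 ^ E <= _); first by apply: leq_mul => //; rewrite ltnW // ltn_pmod // expn_gt0.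
by apply: leq_trans aPhi; rewrite -expnD; apply: leq_2pow.
Qed.

(** * Numerical parameters *)

Lemma fact_le_pow n s : n <= 2 ^ s -> n`! <= 2 ^ (s * n).
Proof.
move=> ns; apply: (@leq_trans (n ^ n)); last by case: n ns => [|n] ns; rewrite ?muln0 // expnM leq_exp2r.
elim: n {ns} => // n IH; rewrite factS expnS leq_mul //; apply: leq_trans IH _.
by case: n => // n; rewrite leq_exp2r.
Qed.

(** [T0 <= 2 ^ v] with [v = 3 s ^ 2 (k + 3)], so the product is at most [2 ^ (4 v + 2)], and 16
    exceeds 12 by enough to absorb the 2. *)
Lemma threshold_bounds k s : k + 3 <= 2 ^ s ->
  let T0 := ((k + 3)`! ^ s) ^ 3 in let u := 16 * s ^ 2 * (k + 3) in
  T0 <= 2 ^ u /\ T0 ^ 2 * T0.+1 ^ 2 < 2 ^ u.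
Proof.
move=> ks T0 u; have s0 : 1 < s by case: s ks {T0 u} => [|[|//]]; rewrite ?expn0 ?expn1; lia.
pose v := 3 * (s * (s * (k + 3))).
have Tv : T0 <= 2 ^ v.
  rewrite /T0 -expnM mulnC; apply: leq_trans (_ : (2 ^ (s * (k + 3))) ^ (3 * s) <= _).
    by rewrite leq_exp2r ?fact_le_pow // muln_gt0 /= ltnW.
  by rewrite -expnM leq_exp2l // /v; lia.
have T2 : T0.+1 <= 2 ^ v.+1 by rewrite expnS; have := expn_gt0 2 v; lia.
have uv : 4 * v + 2 < u.
  rewrite /u /v -mulnn; have : 2 * 2 <= s * s by apply: leq_mul.
  by have : 3 <= k + 3 by [lia]; move=> h1 h2; have := leq_mul h2 h1; lia.
split; first by apply: leq_trans Tv _; rewrite leq_exp2l //; lia.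
apply: leq_ltn_trans (_ : 2 ^ (v * 2) * 2 ^ (v.+1 * 2) < _).
  by apply: leq_mul; rewrite [X in _ <= X](expnM 2 _ 2) leq_exp2r.
by rewrite -expnD ltn_exp2l //; lia.
Qed.

(** [E] is of order [u ^ 2], that is [s ^ 4 (k + 3) ^ 2], and the factor [8 l + 70] with
    [l = 10 + 6 s] contributes one more [s]. The ratio [P = 8 * 2 ^ s * 3 ^ s] is that of [ITD_all]
    for [x = s]. *)
Theorem HTD_large k s h n : 0 < h -> 0 < k -> k + 3 <= 2 ^ s ->
  2 ^ (2 ^ 22 * s ^ 5 * (k + 3) ^ 2) <= n -> HTD k h n.
Proof.
move=> h0 k0 ks; have s2 : 1 < s by case: s ks => [|[|//]]; rewrite ?expn0 ?expn1; lia.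
have s0 := ltnW s2.
pose T0 := ((k + 3)`! ^ s) ^ 3; pose u := 16 * s ^ 2 * (k + 3).
have [Tu T2u] : T0 <= 2 ^ u /\ T0 ^ 2 * T0.+1 ^ 2 < 2 ^ u := threshold_bounds ks.
have T00 : 0 < T0 by rewrite !expn_gt0 fact_gt0.
have HT2 a : T0 <= a -> TD k.+2 a.
  move=> ha; have := @TD_large (k + 3) s a _ ks ha; rewrite addn3; exact.
have HT1 a : T0 <= a -> TD k.+1 a by move=> /HT2; apply: TD_le.
have HT a : T0 <= a -> TD k a by move=> /HT1; apply: TD_le.
have su : 64 * (k + 3) <= u.
  by rewrite /u -mulnn leq_mul2r; apply/orP; right; have := leq_mul s2 s2; lia.
have uk : 4 * k.+2 + 8 <= u by lia.
have uk1 : 4 * k.+1 + 8 <= u by lia.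
have us : 64 * s <= u.
  by have := leq_mul s2 (leqnn s); have := leq_mul (leqnn (s * s)) (_ : 4 <= k + 3); rewrite /u -mulnn; lia.
have uS : u <= 2 ^ (4 + 3 * s).
  have ss : s <= 2 ^ s by rewrite ltnW // ltn_expl.
  have k3 : k + 3 <= 2 ^ s by [].
  rewrite /u (_ : 4 + 3 * s = 4 + s * 2 + s) ?expnD ?leq_mul //; last by lia.
  by rewrite expnM leq_exp2r.
have u256 : 256 <= u by lia.
have uu : 256 * u <= u * u by rewrite leq_mul2r u256 orbT.
pose E := 3 * u ^ 2 + 2 * u.
have E4 : E <= 4 * (u * u) by rewrite /E -mulnn; lia.
have uE : u <= E by rewrite /E -mulnn; lia.
have Ebound : 28 * (E * (8 * (10 + 6 * s) + 70)) <= 2 ^ 22 * s ^ 5 * (k + 3) ^ 2.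
  apply: leq_trans (_ : 2 ^ 5 * (2 ^ 2 * (u * u) * (2 ^ 7 * s)) <= _).
    apply: leq_mul => //; apply: leq_mul; first exact: E4.
    by apply: leq_trans (_ : 128 * s <= _) => //; lia.
  have -> : 2 ^ 22 = 2 ^ 5 * 2 ^ 2 * (2 ^ 4 * 2 ^ 4) * 2 ^ 7 by rewrite -!expnD.
  have -> : u = 2 ^ 4 * s ^ 2 * (k + 3) by [].
  apply: eq_leq; move: (2 ^ 5) (2 ^ 2) (2 ^ 4) (2 ^ 7) (k + 3) => c1 c2 c3 c4 c5; ring.
have Tq : T0 <= 2 ^ (s * u) by apply: leq_trans Tu _; rewrite leq_exp2l // leq_pmull.
have T1 : 64 * 2 ^ s * 3 ^ s * (2 ^ (s * u) + 3 ^ (s * u)) ^ 2 <= 2 ^ E.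
  have h1 : 2 ^ (s * u) + 3 ^ (s * u) <= 2 ^ (2 * (s * u)).+1.
    rewrite expnS mul2n -addnn; apply: leq_add; last exact: pow3_le.
    by rewrite leq_exp2l // leq_pmull.
  apply: leq_trans (_ : 2 ^ 6 * 2 ^ s * 2 ^ (2 * s) * 2 ^ ((2 * (s * u)).+1 * 2) <= _).
    by rewrite [2 ^ (_.+1 * 2)]expnM; apply: leq_mul; [rewrite leq_mul ?pow3_le|rewrite leq_exp2r].
  rewrite -!expnD leq_exp2l // /E -mulnn.
  have : 64 * s * u <= u * u by rewrite leq_mul2r us orbT.
  by clear - us u256 uu; lia.
clearbody u.
have Hpow : forall z e, 0 < z -> E <= e -> HTD k.+1 h (z ^ e).
  by move=> z e z0 Ee; apply: (@HTD_power k.+1 h T0 u) => //.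
move=> nl; apply: (@all_large (HTD k h) E (8 * 2 ^ s * 3 ^ s) (10 + 6 * s)).
- by apply: leq_trans uE; apply: leq_trans u256.
- by rewrite !muln_gt0 !expn_gt0.
- apply: leq_trans E4 _; apply: leq_trans (_ : 4 * (2 ^ (4 + 3 * s) * 2 ^ (4 + 3 * s)) <= _).
    by rewrite leq_mul2l leq_mul.
  by rewrite -[4]/(2 ^ 2) -!expnD leq_exp2l //; clear; lia.
- apply: leq_trans (_ : 2 ^ 3 * 2 ^ s * 2 ^ (2 * s) <= _); first by rewrite leq_mul ?pow3_le.
  by rewrite -!expnD leq_exp2l //; clear; lia.
- by move=> z e z0 Ee; apply: HTD_le (Hpow z e z0 Ee).
- move=> z e j a w z0 Ee jz Hj Sa Saw aE Pw.
  have T0E : T0 <= 2 ^ E by apply: leq_trans Tu _; rewrite leq_exp2l.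
  apply: HTD_op (Hpow z e z0 Ee) jz (HT a (leq_trans T0E aE)) _ _ Sa Saw.
    apply: (ITD_all (T0 := T0) (x := s) (b := u)) => //.
    + by apply: leq_trans ks; rewrite leq_addr.
    + by apply: leq_trans uk; rewrite leq_add2r leq_mul2l /= ltnW.
    + exact: leq_trans T1 aE.
  case: Hj => [|[Sj Hw]]; [by left|right; split=> //].
  by case: Hw => [->|wE]; [apply: TD0|apply: HT; apply: leq_trans wE].
by apply: leq_trans nl; rewrite leq_exp2l.
Qed.

(** * From designs to holey latin squares *)

Lemma count_le1 (T : eqType) (P : pred T) (s : seq T) x y :
  count P s <= 1 -> x \in s -> y \in s -> P x -> P y -> x = y.
Proof.
elim: s => //= z s IH c; rewrite !inE.
have nP u : P z -> u \in s -> P u -> False.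
  move=> Pz us Pu; move: c; rewrite Pz add1n ltnS leqn0 => /eqP c0.
  by have : has P s; [apply/hasP; exists u|rewrite has_count c0].
case/predU1P => [->|xs]; case/predU1P => [->|ys] Px Py //.
- by case: (nP y).
- by case: (nP x).
by apply: IH => //; apply: leq_trans c; apply: leq_addl.
Qed.

(** Two rows of the design index the rows and columns of the squares and every further row holds the
    symbols of one square; orthogonality is then the covering condition on two symbol rows. *)
Lemma N_hls_HTD c h n : 0 < h -> 1 < n -> HTD c.+2 h n -> c <= N_hls h n.
Proof.
move=> h0 n1 H.
have [f [g fg gf]] : exists f : 'I_n * 'I_h -> 'I_(h * n), exists2 g, cancel f g & cancel g f.
  by apply: bij_card; rewrite card_prod !card_ord mulnC.
pose sg x := (g x).1.
have [B HB] := covers_bij fg gf H.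
have {}HB (i j : 'I_c.+2) x y : i != j ->
   count (fun b : {ffun 'I_c.+2 -> 'I_(h * n)} => (b i == x) && (b j == y)) B = (sg x != sg y) by apply: HB.
have Buniq (i j : 'I_c.+2) (b b' : {ffun 'I_c.+2 -> 'I_(h * n)}) : i != j -> b \in B -> b' \in B ->
    b i = b' i -> b j = b' j -> b = b'.
  move=> ij bB b'B ei ej.
  apply: (count_le1 _ bB b'B (P := fun b1 : {ffun 'I_c.+2 -> 'I_(h * n)} => (b1 i == b i) && (b1 j == b j))).
  - by rewrite HB //; case: (_ != _).
  - by rewrite !eqxx.
  - by rewrite ei ej !eqxx.
have Bsg (i j : 'I_c.+2) (b : {ffun 'I_c.+2 -> 'I_(h * n)}) : i != j -> b \in B -> sg (b i) != sg (b j).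
  move=> ij bB; have := HB i j (b i) (b j) ij; case: (_ != _) => // e.
  have : has (fun b1 : {ffun 'I_c.+2 -> 'I_(h * n)} => (b1 i == b i) && (b1 j == b j)) B.
    by apply/hasP; exists b; rewrite ?eqxx.
  by rewrite has_count e.
have Bex (i j : 'I_c.+2) x y : i != j -> sg x != sg y -> exists b : {ffun 'I_c.+2 -> 'I_(h * n)}, [/\ b \in B, b i = x & b j = y].
  move=> ij xy; have := HB i j x y ij; rewrite xy => e.
  have : has (fun b : {ffun 'I_c.+2 -> 'I_(h * n)} => (b i == x) && (b j == y)) B by rewrite has_count e.
  by move=> /hasP[b bB /andP[/eqP bi /eqP bj]]; exists b.
pose r0 : 'I_c.+2 := ord0; pose r1 : 'I_c.+2 := lift ord0 ord0.
pose rr (r : 'I_c) : 'I_c.+2 := lift ord0 (lift ord0 r).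
have r01 : r0 != r1 by [].
have r0r r : r0 != rr r by [].
have r1r r : r1 != rr r by [].
have rrI : injective rr by move=> r r' /lift_inj /lift_inj.
(* At most one block passes through a given cell, and none when row and column lie in the same hole,
   where [ohead] returns [None]. *)
pose Lt (r : 'I_c) : square (h * n) := (\matrix_(i, j)
  omap (fun b : {ffun 'I_c.+2 -> 'I_(h * n)} => b (rr r))
    (ohead [seq b : {ffun 'I_c.+2 -> 'I_(h * n)} <- B | (b r0 == i) && (b r1 == j)]))%R.
have LtP r i j s : Lt r i j = Some s -> exists b : {ffun 'I_c.+2 -> 'I_(h * n)}, [/\ b \in B, b r0 = i, b r1 = j & b (rr r) = s].
  rewrite mxE; case E : (seq.filter _ _) => [|b t]; first by [].
  case=> bs.
  have : b \in [seq b : {ffun 'I_c.+2 -> 'I_(h * n)} <- B | (b r0 == i) && (b r1 == j)] by rewrite E mem_head.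
  by rewrite mem_filter => /andP[/andP[/eqP bi /eqP bj] bB]; exists b.
have LtB r (b : {ffun 'I_c.+2 -> 'I_(h * n)}) : b \in B -> Lt r (b r0) (b r1) = Some (b (rr r)).
  move=> bB; case E : (Lt r (b r0) (b r1)) => [s|].
    by have [b' [b'B e0 e1 <-]] := LtP _ _ _ _ E; rewrite (Buniq r0 r1 b b').
  move: E; rewrite mxE; case E : (seq.filter _ _) => [|b' t] //=.
  have : b \in [seq b' : {ffun 'I_c.+2 -> 'I_(h * n)} <- B | (b' r0 == b r0) && (b' r1 == b r1)].
    by rewrite mem_filter !eqxx bB.
  by rewrite E.
pose hole i := [set x | sg x == i].
have card_hole i : #|hole i| = h.
  have fI : injective (fun s => f (i, s)) by move=> s s' /(can_inj fg) /(congr1 snd).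
  rewrite -[RHS]card_ord -(card_codom fI); apply: eq_card => x; rewrite inE.
  apply/eqP/codomP => [e|[s ->]]; last by rewrite /sg fg.
  by exists (g x).2; rewrite -e /sg -surjective_pairing gf.
have holeI : injective hole.
  move=> i i' e; have : f (i, Ordinal h0) \in hole i by rewrite inE /sg fg.
  by rewrite e inE /sg fg => /eqP.
pose P : {set {set 'I_(h * n)}} := [set hole i | i : 'I_n].
have PP : is_holes h n P.
  apply/and3P; split.
  - apply/and3P; split.
    + apply/eqP/setP => x; rewrite inE; apply/bigcupP; exists (hole (sg x)); last by rewrite inE.
      by apply: imset_f.
    + apply/finset.trivIsetP => _ _ /imsetP[i _ ->] /imsetP[i' _ ->] ne.
      rewrite -finset.setI_eq0; apply/eqP/setP => x; rewrite !inE; apply/negbTE.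
      by apply: contra ne => /andP[/eqP <- /eqP <-].
    + by apply/imsetP => -[i _ e]; have := card_hole i; rewrite -e cards0 => e'; rewrite -e' in h0.
  - by rewrite card_imset // card_ord.
  - by apply/forall_inP => _ /imsetP[i _ ->]; rewrite card_hole.
have same i j : in_same_hole P i j = (sg i == sg j).
  apply/exists_inP/eqP => [[_ /imsetP[t _ ->]]|e].
    by rewrite !inE => /andP[/eqP -> /eqP ->].
  by exists (hole (sg i)); [by apply: imset_f|rewrite !inE e eqxx].
have hls r : is_hls h n P (Lt r).
  apply/and5P; split=> //.
  - apply/forallP => i; apply/forallP => j; rewrite same; apply/eqP.
    have [e|ne] := eqVneq (sg i) (sg j).
      apply/eqP; case E : (Lt r i j) => [s|] //.
      have [b [bB bi bj _]] := LtP _ _ _ _ E.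
      by have := Bsg r0 r1 b r01 bB; rewrite bi bj e eqxx.
    by have [b [bB <- <-]] := Bex r0 r1 i j r01 ne; rewrite LtB.
  - apply/forallP => i; apply/forallP => s; apply/card_le1_eqP => j j'; rewrite !inE.
    move=> /eqP /LtP[b [bB b0 b1 br]] /eqP /LtP[b' [b'B b0' b1' br']].
    by rewrite -b1 -b1' (Buniq r0 (rr r) b b') // ?b0 ?br.
  - apply/forallP => j; apply/forallP => s; apply/card_le1_eqP => i i'; rewrite !inE.
    move=> /eqP /LtP[b [bB b0 b1 br]] /eqP /LtP[b' [b'B b0' b1' br']].
    by rewrite -b0 -b0' (Buniq r1 (rr r) b b') // ?b1 ?br.
  - apply/forall_inP => _ /imsetP[t _ ->]; apply/forall_inP => x xt; apply/forall_inP => s st.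
    move: xt st; rewrite !inE => /eqP xt /eqP st; apply/forallP => y; apply/andP; split; apply/eqP.
      by move=> /LtP[b [bB b0 b1 br]]; have := Bsg r0 (rr r) b (r0r r) bB; rewrite b0 br xt st eqxx.
    by move=> /LtP[b [bB b0 b1 br]]; have := Bsg r1 (rr r) b (r1r r) bB; rewrite b1 br xt st eqxx.
have orth r r' : r != r' -> orthogonal_hls P (Lt r) (Lt r').
  move=> rr'; have rne : rr r != rr r' by rewrite (inj_eq rrI).
  apply/forall_inP => _ /imsetP[i _ ->]; apply/forall_inP => _ /imsetP[i' _ ->]; apply/implyP => ne.
  apply/forall_inP => a ai; apply/forall_inP => a' ai'; move: ai ai'; rewrite !inE => /eqP ai /eqP ai'.
  have aa : sg a != sg a' by rewrite ai ai'; apply: contra ne => /eqP ->.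
  have [b [bB ba ba']] := Bex _ _ _ _ rne aa.
  apply/cards1P; exists (b r0, b r1); apply/setP => -[x y]; rewrite !inE /=.
  apply/andP/eqP => [[/eqP /LtP[b1 [b1B e0 e1 er]] /eqP /LtP[b2 [b2B f0 f1 fr]]]|[-> ->]].
    have e12 : b1 = b2 by apply: (Buniq r0 r1) => //; rewrite ?e0 ?e1.
    have e2b : b2 = b by apply: (Buniq (rr r) (rr r')) => //; rewrite ?ba ?ba' // -e12.
    by rewrite -e0 -e1 e12 e2b.
  by rewrite !LtB // ba ba'.
(* Families are sets, so the squares must be distinct: a block, which exists as [1 < n], has entries
   from different holes in two symbol rows. *)
have LtI : injective Lt.
  move=> r r' e; apply/eqP; apply: contraT => ne.
  have s01 : sg (f (Ordinal (ltnW n1), Ordinal h0)) != sg (f (Ordinal n1, Ordinal h0)) by rewrite /sg !fg.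
  have [b [bB _ _]] := Bex _ _ _ _ r01 s01.
  have := LtB r b bB; rewrite e LtB // => -[e'].
  by have := Bsg (rr r) (rr r') b; rewrite (inj_eq rrI) e' eqxx => /(_ ne bB).
have cS : #|[set Lt r | r : 'I_c]| = c by rewrite card_imset // card_ord.
rewrite -[X in X <= _]cS /N_hls.
apply: (leq_bigmax_cond (F := fun S : {set square (h * n)} => #|S|)).
apply/existsP; exists P; apply/andP; split.
  by apply/forall_inP => _ /imsetP[r _ ->].
apply/forall_inP => _ /imsetP[r _ ->]; apply/forall_inP => _ /imsetP[r' _ ->].
by apply/implyP => ne; apply: orth; apply: contra ne => /eqP ->.
Qed.

(** * Asymptotics *)

Section Asymptotics.

Local Open Scope ring_scope.

(** [s] is logarithmic in [y], so [s ^ 5] costs at most a constant times [y ^ (5 eta)];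
    [g = 2 + 5 eta] is the midpoint of 2 and [delta], and the remaining [x ^ (delta - g)] absorbs
    [K]. *)
Lemma polylog_bound (R : realType) (C delta : R) : 0 <= C -> 2 < delta ->
  exists x0 : R, forall x, x0 <= x -> forall y s : nat, (0 < y)%N -> (2 ^ s.-1 <= y)%N ->
    y%:R <= x + 6 -> C * s%:R ^+ 5 * y%:R ^+ 2 <= x `^ delta.
Proof.
move=> C0 d2; pose eta := (delta - 2) / 10; have eta0 : 0 < eta by rewrite divr_gt0 // subr_gt0.
have l2 : 0 < ln (2 : R) by rewrite ln_gt0 // ltr1n.
pose D := (eta * ln 2)^-1 + 1; pose g := 2 + eta * 5.
have el0 : 0 < eta * ln 2 by rewrite mulr_gt0.
have D0 : 0 <= D by rewrite addr_ge0 // invr_ge0 ltW.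
have gd : 0 < delta - g by rewrite /g /eta; lra.
have g0 : 0 < g by rewrite addr_gt0 // mulr_gt0.
pose K := C * D ^+ 5 * 2 `^ g.
have K0 : 0 <= K by rewrite !mulr_ge0 ?exprn_ge0 ?powR_ge0.
exists (6 + K `^ (delta - g)^-1) => x xx0 y s y0 sy yx.
have x6 : 6 <= x by apply: le_trans xx0; rewrite lerDl powR_ge0.
have x0 : 0 < x by apply: lt_le_trans x6.
have y1 : 1 <= y%:R :> R by rewrite ler1n.
have yp : 0 < y%:R :> R by apply: lt_le_trans y1.
have ye1 : 1 <= y%:R `^ eta :> R by have := ler_powR y1 (ltW eta0); rewrite powRr0.
have sD : s%:R <= D * y%:R `^ eta.
  have h1 : s.-1%:R * ln 2 <= ln (y%:R : R).
    rewrite mulr_natl -lnXn // -natrX ler_ln ?posrE ?ltr0n ?expn_gt0 //.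
    by rewrite ler_nat.
  have h2 : eta * ln (y%:R : R) <= y%:R `^ eta.
    by rewrite -ln_powR; apply/ltW/ln_sublinear/powR_gt0.
  have h3 : s.-1%:R <= (eta * ln 2)^-1 * y%:R `^ eta.
    rewrite mulrC ler_pdivlMr //; apply: le_trans h2.
    by rewrite mulrCA ler_pM2l.
  rewrite /D mulrDl mul1r; apply: le_trans (_ : s.-1%:R + 1 <= _); last exact: lerD.
  by rewrite natr1 ler_nat; exact: leqSpred.
have s5 : s%:R ^+ 5 <= D ^+ 5 * y%:R `^ (eta * 5).
  rewrite powRrM (powR_mulrn 5) ?powR_ge0 // -exprMn.
  by apply: lerXn2r => //; rewrite nnegrE // mulr_ge0 // powR_ge0.
have y2 : y%:R <= 2 * x by lra.
have yg : y%:R `^ g <= 2 `^ g * x `^ g.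
  rewrite -powRM ?(ltW x0) //; apply: ge0_ler_powR => //; first exact: ltW.
  - by rewrite nnegrE ltW.
  - by rewrite nnegrE mulr_ge0 // ltW.
apply: le_trans (_ : C * (D ^+ 5 * y%:R `^ (eta * 5)) * y%:R ^+ 2 <= _).
  by rewrite ler_wpM2r ?exprn_ge0 // ler_wpM2l.
have -> : C * (D ^+ 5 * y%:R `^ (eta * 5)) * y%:R ^+ 2 = C * D ^+ 5 * y%:R `^ g.
  rewrite /g powRD; last by apply/implyP => _; rewrite gt_eqF.
  by rewrite (powR_mulrn 2) ?ltW //; ring.
apply: le_trans (_ : C * D ^+ 5 * (2 `^ g * x `^ g) <= _).
  by rewrite ler_wpM2l // mulr_ge0 // exprn_ge0.
rewrite mulrA -/K.
have -> : x `^ delta = x `^ (delta - g) * x `^ g.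
  by rewrite -powRD ?subrK //; apply/implyP => _; rewrite gt_eqF.
rewrite ler_wpM2r ?powR_ge0 //.
have -> : K = (K `^ (delta - g)^-1) `^ (delta - g).
  by rewrite -powRrM mulVf ?powRr1 // gt_eqF.
apply: ge0_ler_powR; rewrite ?nnegrE ?powR_ge0 ?(ltW x0) ?(ltW gd) //.
by apply: le_trans xx0; rewrite lerDr.
Qed.

End Asymptotics.

Local Open Scope ring_scope.

Theorem theorem4p5 (R : realType) (h : nat) (delta : R)
    (hh : (2 <= h)%N) (hdelta : 2 < delta) :
  exists n0 : nat, forall n : nat, (n0 < n)%N ->
    (ln n%:R) `^ (1 / delta) <= (N_hls h n)%:R :> R.
Proof.
have [C HC] : exists C : nat, forall c s n : nat, (c.+2 + 3 <= 2 ^ s)%N ->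
    (2 ^ (C * s ^ 5 * (c.+2 + 3) ^ 2) <= n)%N -> HTD c.+2 h n.
  by exists (2 ^ 22)%N => c s n cs cn; apply: (HTD_large _ _ cs cn); rewrite // ltnW.
have [x0 Hx0] := polylog_bound (ler0n R C) hdelta.
have d0 : 0 < delta by apply: lt_trans hdelta.
pose X := Num.max x0 1.
exists (Num.truncn (expR (X `^ delta))).+1 => n nn.
have n1 : (1 < n)%N by apply: leq_ltn_trans nn.
have np : 0 < n%:R :> R by rewrite ltr0n ltnW.
have XL : X `^ delta <= ln n%:R.
  rewrite -ler_expR lnK ?posrE //; apply: ltW; apply: lt_trans (truncnS_gt _) _.
  by rewrite ltr_nat.
have L0 : 0 <= ln (n%:R : R) by rewrite ln_ge0 // ler1n ltnW.
set x := ln n%:R `^ (1 / delta).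
have xd : x `^ delta = ln n%:R by rewrite /x -powRrM divfK ?gt_eqF // powRr1.
have X0 : 0 <= X by rewrite le_max ler01 orbT.
have Xx : X <= x.
  have -> : X = (X `^ delta) `^ (1 / delta) by rewrite -powRrM mulrC divfK ?gt_eqF // powRr1.
  by apply: ge0_ler_powR; rewrite ?nnegrE ?powR_ge0 // divr_ge0 // ltW.
have x0x : x0 <= x by apply: le_trans Xx; rewrite le_max lexx.
have xp : 0 <= x by apply: le_trans Xx.
(* More than [x] squares need [c + 2] rows; [c + 2 + 3 = truncn x + 6] is the origin of the 6 in
   [polylog_bound]. *)
pose c := (Num.truncn x).+1; pose s := up_log 2 (c.+2 + 3).
have /andP[/ltnW s1 cs] := up_log_bounds (isT : (1 < 2)%N) (isT : (1 < c.+2 + 3)%N).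
rewrite -/s in s1 cs.
have cx : (c.+2 + 3)%:R <= x + 6.
  have /andP[tx _] := truncn_itv xp.
  have -> : (c.+2 + 3 = Num.truncn x + 6)%N by rewrite /c; clear; move: (Num.truncn x) => t; lia.
  by rewrite natrD lerD2r.
have Hb := Hx0 x x0x _ s (isT : (0 < c.+2 + 3)%N) s1 cx.
have cn : (2 ^ (C * s ^ 5 * (c.+2 + 3) ^ 2) <= n)%N.
  rewrite -(ler_nat R) -ler_ln ?posrE ?np ?ltr0n ?expn_gt0 // natrX lnXn //.
  apply: le_trans (_ : (C * s ^ 5 * (c.+2 + 3) ^ 2)%:R <= _); last first.
    by rewrite -xd natrM (natrM _ C) !natrX.
  (* [ln 2 <= 1], so the exponent of 2 itself may be compared with [ln n]. *)
  apply: ler_wMn2r; have := @le_ln1Dx R 1; rewrite -(natrD _ 1 1); apply.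
  exact: lt_trans (ltrN10 R) ltr01.
apply: le_trans (_ : c%:R <= _); first exact/ltW/truncnS_gt.
rewrite ler_nat; apply: N_hls_HTD => //; first by rewrite ltnW.
exact: HC cs cn.
Qed.
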